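(* Let $\alpha>0$, and let $\mathcal X,\mathcal Y$ be separable metric spaces. Let $\mu$ be the distribution of a pair of random variables $(\mathbf X,\mathbf Y)\in\mathcal X\times\mathcal Y$ and assume that $\mathbb E\|\mathbf X\|^{\alpha^*}<\infty$ and $\mathbb E\|\mathbf Y\|^{\alpha^*}<\infty$. Let $(\mathbf X_i,\mathbf Y_i)$, $i\ge1$, be independent copies of $(\mathbf X,\mathbf Y)$, and let $$\nu_n:=\frac1n\sum_{i=1}^n\delta_{(\mathbf X_i,\mathbf Y_i)}$$ be the (random) empirical distribution of the first $n$ samples. Then, as $n\to\infty$, $\mathrm{dcov}_\alpha(\nu_n)\to\mathrm{dcov}_\alpha(\mu)$ almost surely.
   Context: Both metrics are denoted $d$. Fix points $\mathbf x_o\in\mathcal X$, $\mathbf y_o\in\mathcal Y$ and write $\|\mathbf x\|:=d(\mathbf x,\mathbf x_o)$, $\|\mathbf y\|:=d(\mathbf y,\mathbf y_o)$. Put $\alpha^*:=\max(\alpha,2\alpha-2)$. For a Borel probability measure $\mu$ on $\mathcal X\times\mathcal Y$ that is the distribution of a pair $(\mathbf X,\mathbf Y)$ with $\mathbb E\|\mathbf X\|^{\alpha^*}<\infty$ and $\mathbb E\|\mathbf Y\|^{\alpha^*}<\infty$, put $\mathrm{dcov}_\alpha(\mu):=\mathrm{dcov}_\alpha(\mathbf X,\mathbf Y):=\frac14\mathbb E[\widehat X_\alpha\widehat Y_\alpha]$, where $(\mathbf X_i,\mathbf Y_i)$, $1\le i\le4$, are independent with distribution $\mu$, $\widehat X_\alpha:=d(\mathbf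 X_1,\mathbf X_2)^\alpha-d(\mathbf X_2,\mathbf X_3)^\alpha+d(\mathbf X_3,\mathbf X_4)^\alpha-d(\mathbf X_4,\mathbf X_1)^\alpha$, and $\widehat Y_\alpha$ is defined in the same way with $\mathbf Y_i$ in place of $\mathbf X_i$. For each realization of the samples, $\mathrm{dcov}_\alpha(\nu_n)$ is this functional evaluated at the finitely supported probability measure $\nu_n$; thus it is a random variable. *)

(* Defs.v *)
From HB Require Import structures.
From mathcomp Require Import all_boot all_order all_algebra finmap.
From mathcomp Require Import all_classical all_reals all_analysis.

Set Implicit Arguments.
Unset Strict Implicit.
Unset Printing Implicit Defensive.

Import Order.TTheory GRing.Theory Num.Theory.
Import numFieldTopology.Exports.

Local Open Scope classical_set_scope.
Local Open Scope ring_scope.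

HB.mixin Record Metric_isBorel d (R : numDomainType) T
    & Metric R T & Measurable d T := {
  borel_measurableE : @measurable d T = <<s @open T >>
}.

(* Measurable types are pointed in the library, so these spaces are nonempty;
   the canonical point plays no other role. *)
#[short(type="borelMetricType")]
HB.structure Definition BorelMetric d (R : numDomainType) :=
  {T of Metric R T & Measurable d T & Metric_isBorel d R T}.

Definition separable_space (T : topologicalType) : Prop :=
  exists2 A : set T, countable A & dense A.

Section borel_product.
Context (R : realType) d1 d2 (X : borelMetricType d1 R)
  (Y : borelMetricType d2 R).

Let ball_open_cover (Z : metricType R) (A : set Z) (z : Z) (e : R) :
  dense A -> 0 < e -> exists2 a, A a & exists2 q : rat,
    ball a (ratr q : R) z & ball a (ratr q : R) `<=` ball z e.
Proof.
move=> dA e0.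
have e20 : 0 < e / 2 by rewrite divr_gt0.
have [a [za Aa]] : (ball z (e / 2))° `&` A !=set0.
  apply: dA; last exact: open_interior.
  by exists z; apply: nbhsx_ballx.
have {}za : ball z (e / 2) a by exact: interior_subset za.
have : mdist z a < e / 2 by move: za; rewrite ballEmdist.
move=> /rat_in_itvoo[q]; rewrite in_itv/= => /andP[zq qe].
exists a => //; exists q.
  by rewrite ballEmdist/= metric_sym.
move=> w aw; rewrite (splitr e).
apply: (ball_triangle za); apply: le_ball aw; exact: ltW.
Qed.

Let borel_ball d (Z : borelMetricType d R) (z : Z) (e : R) :
  measurable (ball z e).
Proof.
rewrite borel_measurableE; apply: sub_sigma_algebra.
rewrite openE => w; rewrite /interior ballEmdist /= => zw.
rewrite -nbhs_ballE; exists (e - mdist z w) => /=; first by rewrite subr_gt0.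
move=> v; rewrite ballEmdist /= => wv.
by rewrite (le_lt_trans (metric_triangle _ w _))// -ltrBrDl.
Qed.

(* The library's product sigma-algebra is the Borel sigma-algebra of the
   product space, hence a measure on [X * Y] is a Borel measure. *)
Lemma borel_prod : separable_space X -> separable_space Y ->
  @measurable _ (X * Y)%type = <<s @open (X * Y)%type >>.
Proof.
move=> [A cA dA] [B cB dB]; rewrite eqEsubset; split.
  rewrite measurable_prod_measurableType.
  apply: smallest_sub; first exact: smallest_sigma_algebra.
  move=> _ [C mC] [D mD] <-.
  have -> : C `*` D = (fst @^-1` C) `&` (snd @^-1` D) by [].
  have pre (U V : topologicalType) (f : V -> U) (E : set U) :
      continuous f -> <<s @open U >> E -> <<s @open V >> (f @^-1` E).
    move=> cf; move: E; apply: smallest_sub.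
      split => [||F mF].
      - by rewrite /= preimage_set0; exact: sigma_algebra0.
      - move=> E mE /=; rewrite setTD preimage_setC -setTD.
        exact: sigma_algebraCD.
      - by rewrite /= preimage_bigcup; exact: sigma_algebra_bigcup.
    by move=> E oE; apply: sub_sigma_algebra; exact: open_comp.
  move: mC mD; rewrite !borel_measurableE => mC mD.
  apply: (@measurableI _ (g_sigma_algebraType (@open (X * Y)%type))).
    by apply: pre mC => x; exact: cvg_fst.
  by apply: pre mD => x; exact: cvg_snd.
apply: smallest_sub; first exact: sigma_algebra_measurable.
move=> O oO.
pose I := (A `*` setT) `*` (B `*` setT) : set ((X * rat) * (Y * rat)).
have cI : countable I by do !apply: countableX => //; exact: countableP.
pose K := I `&` [set i | ball i.1.1 (ratr i.1.2 : R) `*`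
  ball i.2.1 (ratr i.2.2 : R) `<=` O].
have -> : O = \bigcup_(i in K) (ball i.1.1 (ratr i.1.2 : R) `*`
    ball i.2.1 (ratr i.2.2 : R)).
  rewrite eqEsubset; split; last by move=> z [i [_]] ; exact.
  move=> [x y] Oxy.
  have : nbhs (x, y) O by exact: open_nbhs_nbhs.
  rewrite -nbhs_ballE => -[e /= e0 xyO].
  have [a Aa [q xq qe]] := ball_open_cover x dA e0.
  have [b Bb [r yr re]] := ball_open_cover y dB e0.
  exists ((a, q), (b, r)) => //; split => // -[u v] [/= /qe ? /re ?].
  exact: xyO.
have : countable K.
  exact: sub_countable (subset_card_le (@subIsetl _ _ _)) cI.
move=> /pfcard_geP[->|[g]]; first by rewrite bigcup_set0.
rewrite -(image_eq g) bigcup_image; apply: bigcupT_measurable => n.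
by apply: measurableX; exact: borel_ball.
Qed.

End borel_product.

Section independence.
Context d d' (Omega : measurableType d) (T : measurableType d') (R : realType)
  (P : probability Omega R).

Definition mutually_independent (I : choiceType) (Z : I -> {RV P >-> T}) :=
  forall (J : {fset I}) (A : I -> set T), (forall i, measurable (A i)) ->
    P (\bigcap_(i in [set` J]) (Z i @^-1` A i)) =
    (\prod_(i <- J) P (Z i @^-1` A i))%E.

Definition independent_copies d0 (Omega0 : measurableType d0)
    (P0 : probability Omega0 R) (Z0 : {RV P0 >-> T})
    (I : choiceType) (Z : I -> {RV P >-> T}) :=
  mutually_independent Z /\
  forall i (A : set T), measurable A ->
    distribution P (Z i) A = distribution P0 Z0 A.

End independence.

Section empirical.
Context d (T : measurableType d) (R : realType).

(* The zero measure for [n = 0], a probability measure for [n > 0]. *)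
Definition empirical (z : nat -> T) (n : nat) : set T -> \bar R :=
  mscale (n%:R^-1)%:nng (msum (fun i => \d_(z i)) n).

HB.instance Definition _ z n := Measure.on (empirical z n).

Let empirical_setT z n : empirical z n.+1 setT = 1%E.
Proof.
rewrite /empirical /mscale /= /msum.
under eq_bigr do rewrite /= diracT.
by rewrite sumEFin sumr_const card_ord -EFinM mulVf// pnatr_eq0.
Qed.

HB.instance Definition _ z n :=
  Measure_isProbability.Build _ _ _ (empirical z n.+1) (empirical_setT z n).

End empirical.
Arguments empirical {d T R} z n.

Section distance_covariance.
Context (R : realType).

Definition alpha_star (alpha : R) : R := Num.max alpha (2 * alpha - 2).

Definition hat (T : metricType R) (alpha : R) (t1 t2 t3 t4 : T) : R :=
  mdist t1 t2 `^ alpha - mdist t2 t3 `^ alpha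
  + mdist t3 t4 `^ alpha - mdist t4 t1 `^ alpha.

(* The four independent pairs with law [mu] are the coordinates of the product
   space; the value is extended-real as it is the library's expectation. *)
Definition dcov d1 d2 (X : borelMetricType d1 R) (Y : borelMetricType d2 R)
    (alpha : R) (mu : probability (X * Y)%type R) : \bar R :=
  ((4^-1)%:E * 'E_((mu \x mu) \x (mu \x mu))
     [fun z : ((X * Y) * (X * Y)) * ((X * Y) * (X * Y)) =>
        let: ((z1, z2), (z3, z4)) := z in
        (hat alpha z1.1 z2.1 z3.1 z4.1 * hat alpha z1.2 z2.2 z3.2 z4.2)%R])%E.

End distance_covariance.

(* Main.v *)
(* Write [g x = (1 + d(x, xo))^(alpha_star / 2)] and [h] for its analogue on [Y].
   Pairing in [hat] the two distances issued from the point farthest from [xo]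
   gives [|hat alpha x1 x2 x3 x4| <= C g(x1) g(x2) g(x3) g(x4)], and moving each
   point by at most [delta] changes [hat] by at most [o(1)] times the same
   product. Hence the kernel of [dcov] is dominated by [prod_i G(z_i)] with
   [G(x, y) = g(x) h(y) <= (g(x)^2 + h(y)^2) / 2] integrable, and up to an
   arbitrarily small multiple of that product it factors through a
   countable-valued quantization of [X * Y], which exists by separability. Up to
   the [G]-mass of a tail of cells, its fourfold integral is thus a polynomial in
   the masses of finitely many cells, so the strong law of large numbers for
   these masses, for [G] and for the tails (countably many functions) suffices.

   The strong law itself only uses pairwise independence: Chebyshev along the
   squares for bounded functions, and a maximal bound along the powers of 2 for
   the remainder after truncation. *)

Require Import Defs.
From HB Require Import structures.
From mathcomp Require Import all_boot all_order all_algebra finmap.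
From mathcomp Require Import all_classical all_reals all_analysis measurable_realfun.
From mathcomp Require Import ring lra zify.

Set Implicit Arguments.
Unset Strict Implicit.
Unset Printing Implicit Defensive.

Import Order.TTheory GRing.Theory Num.Theory.
Import numFieldTopology.Exports numFieldNormedType.Exports.

Local Open Scope classical_set_scope.
Local Open Scope ring_scope.

(** * Integration *)

Section ae_convergence.
Context d (Omega : measurableType d) (R : realType)
  (P : {measure set Omega -> \bar R}).

(** By monotone convergence the series of the [f k] has a finite integral, so it is finite almost
    everywhere, and the terms of a convergent series tend to 0. Both the Chebyshev bounds and the
    Borel-Cantelli argument below enter in this form. *)
Lemma ae_cvg0_summable (f : nat -> Omega -> R) (C : R) :
  (forall k, measurable_fun setT (f k)) -> (forall k w, 0 <= f k w) ->
  (forall n, (\sum_(0 <= k < n) \int[P]_w (f k w)%:E <= C%:E)%E) ->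
  {ae P, forall w, f k w @[k --> \oo] --> 0}.
Proof.
move=> mf f0 fC.
have mEf k : measurable_fun setT (fun w => (f k w)%:E) by exact/measurable_EFinP.
have Ef0 k w : (0 <= (f k w)%:E)%E by rewrite lee_fin.
have msum : measurable_fun setT (fun w => \sum_(k <oo) (f k w)%:E)%E.
  exact: ge0_emeasurable_sum.
have isum : P.-integrable setT (fun w => \sum_(k <oo) (f k w)%:E)%E.
  apply/integrableP; split => //.
  under eq_integral do rewrite gee0_abs ?nneseries_ge0//.
  rewrite integral_nneseries//.
  apply: (@le_lt_trans _ _ C%:E); last exact: ltry.
  apply: lime_le; last exact: nearW.
  by apply: is_cvg_nneseries => k _ _; exact: integral_ge0.
have := integrable_ae measurableT isum.
apply: filterS => w /(_ I) sfin.
have tail : (\sum_(n <= k <oo) (f k w)%:E)%E @[n --> \oo] --> 0%E.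
  apply: nneseries_tail_cvg => [|k _]; last exact: Ef0.
  by rewrite ltey_eq sfin.
suff /fine_cvgP[] : (f k w)%:E @[k --> \oo] --> 0%:E by [].
apply: (@squeeze_cvge _ _ _ _ (fun=> 0%E) _
  (fun n => \sum_(n <= k <oo) (f k w)%:E)%E) => //; last exact: cvg_cst.
near=> n; rewrite Ef0/=.
rewrite (nneseries_split n 1)// addn1 big_nat1 leeDl//.
by apply: nneseries_ge0 => k _ _; exact: Ef0.
Unshelve. all: end_near. Qed.

End ae_convergence.

Section product_integral.
Context d1 d2 (T1 : measurableType d1) (T2 : measurableType d2) (R : realType)
  (m1 : probability T1 R) (m2 : probability T2 R).
Variables (f : T1 -> R) (g : T2 -> R).
Hypotheses (f0 : forall x, 0 <= f x) (g0 : forall y, 0 <= g y).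

Let product_integral_ge0 : measurable_fun setT f -> measurable_fun setT g ->
  (\int[m1 \x m2]_z (f z.1 * g z.2)%:E =
   \int[m1]_x (f x)%:E * \int[m2]_y (g y)%:E)%E.
Proof.
move=> mf mg.
rewrite fubini_tonelli1/=; last 2 first.
- apply/measurable_EFinP; apply: measurable_funM.
    exact: (measurableT_comp mf measurable_fst).
  exact: (measurableT_comp mg measurable_snd).
- by move=> z; rewrite lee_fin mulr_ge0.
rewrite /fubini_F/=.
transitivity (\int[m1]_x ((f x)%:E * \int[m2]_y (g y)%:E))%E.
  apply: eq_integral => x _; under eq_integral do rewrite EFinM.
  rewrite ge0_integralZl//.
  - exact/measurable_EFinP.
  - by move=> y _; rewrite lee_fin.
  by rewrite lee_fin.
rewrite ge0_integralZr//.
- exact/measurable_EFinP.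
- by move=> x _; rewrite lee_fin.
- by apply: integral_ge0 => y _; rewrite lee_fin.
Qed.

Hypotheses (intf : m1.-integrable setT (EFin \o f))
  (intg : m2.-integrable setT (EFin \o g)).

Lemma integrable_prodM :
  (m1 \x m2)%E.-integrable setT (fun z => (f z.1 * g z.2)%:E).
Proof.
have mf : measurable_fun setT f.
  by apply/measurable_EFinP; exact: measurable_int intf.
have mg : measurable_fun setT g.
  by apply/measurable_EFinP; exact: measurable_int intg.
apply/integrableP; split.
  apply/measurable_EFinP; apply: measurable_funM.
    exact: (measurableT_comp mf measurable_fst).
  exact: (measurableT_comp mg measurable_snd).
under eq_integral do rewrite gee0_abs ?lee_fin ?mulr_ge0//.
rewrite product_integral_ge0// ltey_eq fin_numM//.
  exact: integrable_fin_num intf.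
exact: integrable_fin_num intg.
Qed.

Lemma Rintegral_prodM :
  \int[(m1 \x m2)%E]_z (f z.1 * g z.2) = \int[m1]_x f x * \int[m2]_y g y.
Proof.
rewrite /Rintegral product_integral_ge0 ?fineM//.
- exact: integrable_fin_num intf.
- exact: integrable_fin_num intg.
- by apply/measurable_EFinP; exact: measurable_int intf.
- by apply/measurable_EFinP; exact: measurable_int intg.
Qed.

End product_integral.

Section transfer_law.
Context d d' (Omega : measurableType d) (S : measurableType d') (R : realType)
  (P : {measure set Omega -> \bar R}) (m : {measure set S -> \bar R})
  (phi : Omega -> S).
Hypotheses (mphi : measurable_fun setT phi)
  (law : forall A, measurable A -> P (phi @^-1` A) = m A).

(** The law is assumed set by set for a plain function [phi], so that the same change of variables
    serves one sample [Z i] and a pair [(Z i, Z j)]. *)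
Lemma ge0_integral_law (f : S -> \bar R) :
  measurable_fun setT f -> (forall x, 0 <= f x)%E ->
  (\int[P]_w f (phi w) = \int[m]_x f x)%E.
Proof.
move=> mf f0.
transitivity (\int[pushforward P phi]_x f x)%E.
  by rewrite ge0_integral_pushforward// preimage_setT.
by apply: eq_measure_integral => A mA _; exact: law.
Qed.

Lemma integrable_law (f : S -> \bar R) :
  m.-integrable setT f -> P.-integrable setT (f \o phi).
Proof.
move=> /integrableP[mf foo]; apply/integrableP; split.
  exact: measurableT_comp.
rewrite (ge0_integral_law (f := abse \o f))//.
  exact: measurableT_comp.
by move=> x; exact: abse_ge0.
Qed.

Lemma ge0_Rintegral_law (f : S -> R) :
  measurable_fun setT f -> (forall x, 0 <= f x) ->
  \int[P]_w f (phi w) = \int[m]_x f x.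
Proof.
move=> mf f0; rewrite /Rintegral.
rewrite -(ge0_integral_law (f := EFin \o f))//; exact/measurable_EFinP.
Qed.

End transfer_law.

Lemma Rintegral_sum d (T : measurableType d) (R : realType)
    (mu : {measure set T -> \bar R}) (I : Type) (s : seq I) (f : I -> T -> R) :
    (forall i, mu.-integrable setT (EFin \o f i)) ->
  \int[mu]_x (\sum_(i <- s) f i x) = \sum_(i <- s) \int[mu]_x f i x.
Proof.
move=> intf; rewrite /Rintegral.
under eq_integral do rewrite -sumEFin.
rewrite integral_sum// -sum_fine// => i _.
exact: integrable_fin_num (intf i).
Qed.

Lemma ge0_bounded_integrable d (T : measurableType d) (R : realType)
    (P : {finite_measure set T -> \bar R}) (M : R) (f : T -> R) :
    measurable_fun setT f -> (forall x, 0 <= f x <= M) ->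
  P.-integrable setT (EFin \o f).
Proof.
move=> mf fM; apply: measurable_bounded_integrable => //.
  exact: fin_num_fun_lty.
exists M; split; first exact: num_real.
move=> y My x _ /=; have /andP[f0 /le_trans fle] := fM x.
by rewrite ger0_norm// fle// ltW.
Qed.

Lemma Rintegral_probability_cst d (T : measurableType d) (R : realType)
  (P : probability T R) (r : R) : \int[P]_x r = r.
Proof.
rewrite Rintegral_cst// -[RHS]mulr1; congr (_ * _).
exact: (congr1 fine (probability_setT P)).
Qed.

(** * The strong law of large numbers *)

Section pairwise_iid.
Context d d' (Omega : measurableType d) (T : measurableType d') (R : realType)
  (P : probability Omega R) (mu : probability T R) (Z : nat -> {mfun Omega >-> T}).

Definition pairwise_iid :=
  (forall i A, measurable A -> P (Z i @^-1` A) = mu A) /\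
  (forall i j A B, i != j -> measurable A -> measurable B ->
    P (Z i @^-1` A `&` Z j @^-1` B) = (mu A * mu B)%E).

Hypothesis iid : pairwise_iid.

(** A product measure is determined by its values on rectangles, where the claim is pairwise
    independence. *)
Lemma pairwise_law i j : i != j -> forall A, measurable A ->
  P ((fun w => (Z i w, Z j w)) @^-1` A) = (mu \x mu)%E A.
Proof.
move=> ij A mA.
have mZ : measurable_fun setT (fun w => (Z i w, Z j w)).
  exact: measurable_fun_pair.
pose ZZ : {mfun Omega >-> (T * T)%type} :=
  HB.pack (fun w => (Z i w, Z j w)) (isMeasurableFun.Build _ _ _ _ _ mZ).
apply/esym; apply: (@product_measure_unique _ _ _ _ _ _ _ (distribution P ZZ)).
  by move=> B C mB mC; exact: iid.2.
exact: mA.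
Qed.

Variables (u : T -> R) (M : R).
Hypotheses (mu_ : measurable_fun setT u) (uM : forall x, 0 <= u x <= M).

Let m := \int[mu]_x u x.
Let q := \int[mu]_x (u x ^+ 2).

Let u0 x : 0 <= u x. Proof. by have /andP[] := uM x. Qed.

Let M0 : 0 <= M. Proof. by have /andP[+ +] := uM point; exact: le_trans. Qed.

Let muZ i : measurable_fun setT (u \o Z i).
Proof. exact: measurableT_comp. Qed.

Let iu i : P.-integrable setT (EFin \o (u \o Z i)).
Proof. by apply: (@ge0_bounded_integrable _ _ _ _ M) => // w; exact: uM. Qed.

Let iuu i j : P.-integrable setT (EFin \o ((u \o Z i) \* (u \o Z j))).
Proof.
apply: (@ge0_bounded_integrable _ _ _ _ (M * M)).
  exact: measurable_funM.
move=> w /=; have /andP[? ?] := uM (Z i w); have /andP[? ?] := uM (Z j w).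
by rewrite mulr_ge0//= ler_pM.
Qed.

Let EuM i j : \int[P]_w (u (Z i w) * u (Z j w)) = if i == j then q else m ^+ 2.
Proof.
case: eqVneq => [->|ij].
  rewrite /q -(ge0_Rintegral_law _ (iid.1 j))//.
  - exact: measurable_funX.
  - by move=> x; rewrite exprn_ge0.
transitivity (\int[(mu \x mu)%E]_z (u z.1 * u z.2)).
  apply: (ge0_Rintegral_law (f := fun z => u z.1 * u z.2) _ (pairwise_law ij)).
  - exact: measurable_fun_pair.
  - apply: measurable_funM.
      exact: (measurableT_comp mu_ measurable_fst).
    exact: (measurableT_comp mu_ measurable_snd).
  - by move=> z; rewrite mulr_ge0.
by rewrite Rintegral_prodM ?expr2//; apply: (@ge0_bounded_integrable _ _ _ _ M).
Qed.

Let Eu i : \int[P]_w (u (Z i w)) = m.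
Proof. by rewrite (ge0_Rintegral_law _ (iid.1 i)). Qed.

(** Expanding the square leaves [n] diagonal products of mean [q] and [n(n-1)] off-diagonal ones of
    mean [m ^+ 2], so only joint laws of pairs occur. Boundedness of [u] makes every term
    integrable. *)
Lemma pairwise_iid_variance n :
  \int[P]_w ((\sum_(i < n) u (Z i w) - n%:R * m) ^+ 2) = n%:R * (q - m ^+ 2).
Proof.
have iS : P.-integrable setT (EFin \o (fun w => \sum_(i < n) u (Z i w))).
  under [X in integrable _ _ X]eq_fun do rewrite /= -sumEFin.
  by apply: integrable_sum => // i _; exact: iu.
have iSS : P.-integrable setT
    (EFin \o (fun w => \sum_(i < n) \sum_(j < n) u (Z i w) * u (Z j w))).
  under [X in integrable _ _ X]eq_fun do rewrite /= -sumEFin.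
  apply: integrable_sum => // i _.
  under [X in integrable _ _ X]eq_fun do rewrite /= -sumEFin.
  by apply: integrable_sum => // j _; exact: iuu.
have ic c : P.-integrable setT (EFin \o (fun=> c : R)).
  exact: finite_measure_integrable_cst.
transitivity (\int[P]_w ((\sum_(i < n) \sum_(j < n) u (Z i w) * u (Z j w)
    - (2 * n%:R * m) * \sum_(i < n) u (Z i w)) + (n%:R * m) ^+ 2)).
  apply: eq_Rintegral => w _.
  by rewrite -big_distrlr/=; ring.
have iZ := integrableZl measurableT (2 * n%:R * m) iS.
rewrite RintegralD//; last exact: (integrableB measurableT iSS iZ).
rewrite RintegralB//.
rewrite RintegralZl// Rintegral_probability_cst.
have iuS i : P.-integrable setT
    (EFin \o (fun w => \sum_(j < n) u (Z i w) * u (Z j w))).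
  under [X in integrable _ _ X]eq_fun do rewrite /= -sumEFin.
  by apply: integrable_sum => // j _; exact: iuu.
rewrite (@Rintegral_sum _ _ _ P 'I_n _ (fun i w => u (Z i w))); last first.
  by move=> i; exact: iu.
rewrite (@Rintegral_sum _ _ _ P 'I_n _
  (fun i w => \sum_(j < n) u (Z i w) * u (Z j w))); last first.
  by move=> i; exact: iuS.
rewrite (eq_bigr (fun=> q + (m ^+ 2) *+ n.-1)) => [|i _]; last first.
  rewrite (@Rintegral_sum _ _ _ P 'I_n _ (fun j w => u (Z i w) * u (Z j w)));
    last by move=> j; exact: iuu.
  rewrite (bigD1 i)//= EuM eqxx; congr (_ + _).
  rewrite (eq_bigr (fun=> m ^+ 2)) => [|j ji].
    by rewrite sumr_const cardC1 card_ord.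
  by rewrite EuM eq_sym val_eqE (negPf ji).
rewrite [X in _ - _ * X](eq_bigr (fun=> m)) => [|i _]; last exact: Eu.
rewrite !sumr_const !card_ord.
(* The number [n.-1] of off-diagonal entries in a row equals [n - 1] in the reals only for positive
   [n]. *)
have [n0|n0] := posnP n; first by rewrite n0 !mulr0n; ring.
have nE : n%:R = n.-1%:R + 1 :> R by rewrite natr1 prednK.
by rewrite -(mulr_natr (q + _)) -(mulr_natr m) -(mulr_natr (m ^+ 2)) nE; ring.
Qed.

End pairwise_iid.

(** * Passing from squares or powers of 2 to all indices *)

Section interpolation.
Context (R : realType).
Implicit Types (S : nat -> R).

Lemma ge0_increments_le S (M : R) :
  (forall n, 0 <= S n.+1 - S n <= M) ->
  forall n k, 0 <= S (n + k)%N - S n <= k%:R * M.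
Proof.
move=> SM n; elim=> [|k /andP[IH0 IHM]]; first by rewrite addn0 subrr mul0r lexx.
have /andP[inc0 incM] := SM (n + k)%N; rewrite addnS -natr1.
by apply/andP; split; nra.
Qed.

Lemma nat_between_squares n : (0 < n)%N -> exists k, (k.+1 ^ 2 <= n < k.+2 ^ 2)%N.
Proof.
elim: n => // -[_ _|n IH _]; first by exists 0%N.
have [k /andP[kn nk]] := IH isT.
have [nk2|nk2] := ltnP n.+2 (k.+2 ^ 2); last by exists k.+1; rewrite nk2/=; lia.
by exists k; rewrite nk2 andbT; lia.
Qed.

(* Between consecutive squares [N <= n] the ratio [n / N] tends to 1, so that
   an average with bounded increments is controlled by its values at squares. *)
Lemma cvg_average_squares S (M m : R) :
  (forall n, 0 <= S n.+1 - S n <= M) ->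
  (S (k.+1 ^ 2)%N / (k.+1 ^ 2)%:R - m) ^+ 2 @[k --> \oo] --> 0 ->
  S n / n%:R @[n --> \oo] --> m.
Proof.
move=> SM Sm; have M0 : 0 <= M.
  by have /andP[+ +] := SM 0%N; exact: le_trans.
apply/cvgrPdist_le => /= e e0.
have e20 : 0 < e / 2 by lra.
have /cvgrPdist_lt/(_ _ (exprn_gt0 2 e20))[K _ SK] := Sm.
(* For [k >= L] this makes [3 (M + |m|)] at most [(e / 2)(k + 1)]. The 3 comes from the gap between
   the squares: [n - N < 2k + 3], hence [n - N <= 3 (k + 1)]. *)
pose L := Num.truncn (3 * (M + `|m|) / (e / 2)).
near=> n.
have n0 : (0 < n)%N by near: n; exists 1%N.
have [k /andP[kn nk]] := nat_between_squares n0.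
have Kn : ((K + L).+2 ^ 2 <= n)%N by near: n; exists ((K + L).+2 ^ 2)%N.
have KLk : (K + L <= k)%N.
  by have := leq_ltn_trans Kn nk; rewrite ltn_exp2r// !ltnS => /ltnW.
have /SK/= : (K <= k)%N by apply: leq_trans KLk; exact: leq_addr.
set N := (k.+1 ^ 2)%N in kn *.
have N0 : 0 < N%:R :> R by rewrite ltr0n expn_gt0.
rewrite sub0r normrN normrX ltr_pXn2r ?nnegrE //; last exact: ltW.
move=> SN.
have nR0 : 0 < n%:R :> R by rewrite ltr0n.
have [j nE] : exists j, n = (N + j)%N by exists (n - N)%N; rewrite subnKC.
have jk : (j <= 3 * k.+1)%N by rewrite nE /N in nk; rewrite /N; lia.
have /andP[inc0 incM] := ge0_increments_le SM N j.
have Lk : 3 * (M + `|m|) <= e / 2 * k.+1%:R.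
  rewrite [leRHS]mulrC -ler_pdivrMr//.
  have /ltW := truncnS_gt (3 * (M + `|m|) / (e / 2)); move=> /le_trans; apply.
  by rewrite ler_nat ltnS (leq_trans _ KLk)// leq_addl.
have SNm : `|S N - m * N%:R| <= e / 2 * N%:R.
  have -> : S N - m * N%:R = (S N / N%:R - m) * N%:R.
    by rewrite mulrBl divfK// gt_eqF.
  by rewrite normrM (gtr0_norm N0) ler_wpM2r// ltW.
have -> : m - S n / n%:R = - ((S n - m * n%:R) / n%:R).
  by rewrite mulrBl mulfK ?gt_eqF// opprB.
rewrite normrN normrM normfV (gtr0_norm nR0) ler_pdivrMr//.
have nNj : n%:R = N%:R + j%:R :> R by rewrite nE natrD.
have j0 : 0 <= j%:R :> R by [].
have jR : j%:R <= 3 * k.+1%:R :> R by rewrite -natrM ler_nat.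
have NE : N%:R = k.+1%:R * k.+1%:R :> R by rewrite /N natrX expr2.
(* The first term is at most [(e / 2) N] by convergence along squares. The other two together are at
   most [j (M + |m|)], again at most [(e / 2) N] since [N] is the square of [k + 1]. *)
have split : S n - m * n%:R = (S N - m * N%:R) + (S n - S N) - j%:R * m.
  by rewrite nNj; ring.
have jm : `|j%:R * m| <= j%:R * `|m| by rewrite normrM ger0_norm.
rewrite split (le_trans (ler_normB _ _))// (le_trans (lerD (ler_normD _ _) jm))//.
rewrite nE (ger0_norm inc0) -nE.
have bound : j%:R * (M + `|m|) <= e / 2 * N%:R.
  rewrite NE mulrA; apply: le_trans (ler_wpM2r _ Lk) => //.
  by rewrite mulrAC; apply: ler_wpM2r => //; rewrite addr_ge0.
rewrite mulrDr in bound; rewrite -nE in incM.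
have ej : 0 <= e * j%:R by rewrite mulr_ge0// ltW.
by rewrite nNj mulrDr; lra.
Unshelve. all: end_near. Qed.

(** If [2^k <= n < 2^(k+1)], monotonicity bounds [S n] by the value at [2^(k+1)], and
    [2^(k+1) <= 2n] costs the factor 2. *)
Lemma le_average_dyadic S (c : R) :
  (forall n, S n <= S n.+1) -> 0 <= c ->
  (\forall k \near \oo, S (2 ^ k)%N <= (2 ^ k)%:R * c) ->
  \forall n \near \oo, S n <= 2 * n%:R * c.
Proof.
move=> /nondecreasing_seqP ndS c0 [K _ SK].
exists (2 ^ K)%N => // n /= Kn.
have n0 : (0 < n)%N by apply: leq_trans Kn; rewrite expn_gt0.
have /andP[kn nk] := trunc_log_bounds (isT : (1 < 2)%N) n0.
set k := trunc_log 2 n in kn nk.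
have Kk : (K <= k)%N.
  by rewrite -ltnS -(ltn_exp2l _ _ (isT : (1 < 2)%N)) (leq_ltn_trans Kn).
apply: (le_trans (ndS _ _ (ltnW nk))).
apply: (le_trans (SK _ _)); first exact: leqW.
by apply: ler_wpM2r => //; rewrite expnS natrM ler_wpM2l// ler_nat.
Qed.

End interpolation.

Section strong_law.
Context d d' (Omega : measurableType d) (T : measurableType d') (R : realType)
  (P : probability Omega R) (mu : probability T R) (Z : nat -> {mfun Omega >-> T}).
Hypothesis iid : pairwise_iid P mu Z.

Let Rintegral_EFin (f : Omega -> R) : P.-integrable setT (EFin \o f) ->
  (\int[P]_w (f w)%:E = (\int[P]_w f w)%:E)%E.
Proof. by move=> intf; rewrite /Rintegral fineK//; exact: integrable_fin_num intf. Qed.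

Let sum_measurable n (u : T -> R) : measurable_fun setT u ->
  measurable_fun setT (fun w => \sum_(i < n) u (Z i w)).
Proof. by move=> mu_; apply: measurable_sum => i; exact: measurableT_comp. Qed.

Let average_dev (u : T -> R) (n : nat) w :=
  ((\sum_(i < n) u (Z i w)) / n%:R - \int[mu]_x u x) ^+ 2.

Let measurable_average_dev u n : measurable_fun setT u ->
  measurable_fun setT (average_dev u n).
Proof.
move=> mu_; apply: measurable_funX; apply: measurable_funB => //.
by apply: measurable_funM => //; exact: sum_measurable.
Qed.

(** This is the variance formula divided by the square of [n], with the negative term dropped. The
    bound [M] serves integrability only and does not enter the estimate, so it may later grow with
    the truncation level. *)
Let average_dev_le (u : T -> R) (M : R) (n : nat) : (0 < n)%N ->
  measurable_fun setT u -> (forall x, 0 <= u x <= M) ->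
  (\int[P]_w (average_dev u n w)%:E <= (n%:R^-1 * \int[mu]_x (u x ^+ 2))%:E)%E.
Proof.
move=> n0 mu_ uM.
have nR0 : 0 < n%:R :> R by rewrite ltr0n.
have iS : P.-integrable setT
    (EFin \o (fun w => (\sum_(i < n) u (Z i w) - n%:R * \int[mu]_x u x) ^+ 2)).
  pose B := n%:R * M + `|n%:R * \int[mu]_x u x|.
  apply: (@ge0_bounded_integrable _ _ _ _ (B ^+ 2)).
    by apply: measurable_funX; apply: measurable_funB => //; exact: sum_measurable.
  move=> w; rewrite sqr_ge0/= -(real_normK (num_real (_ - _))).
  have S0 : 0 <= \sum_(i < n) u (Z i w).
    by rewrite sumr_ge0// => i _; have /andP[] := uM (Z i w).
  have XB : `|\sum_(i < n) u (Z i w) - n%:R * \int[mu]_x u x| <= B.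
    rewrite (le_trans (ler_normB _ _))// lerD2r ger0_norm//.
    rewrite mulrC mulr_natr -[n in leRHS]card_ord -sumr_const ler_sum// => i _.
    by have /andP[] := uM (Z i w).
  by rewrite lerXn2r// nnegrE// (le_trans _ XB).
have devE : average_dev u n = fun w => (n%:R ^- 2) *
    (\sum_(i < n) u (Z i w) - n%:R * \int[mu]_x u x) ^+ 2.
  by apply/funext => w; rewrite /average_dev; field; rewrite gt_eqF.
rewrite devE Rintegral_EFin; last exact: (integrableZl measurableT _ iS).
rewrite RintegralZl// (pairwise_iid_variance iid mu_ uM) lee_fin.
rewrite [leLHS](_ : _ = n%:R^-1 * (\int[mu]_x (u x ^+ 2) - (\int[mu]_x u x) ^+ 2)).
  by rewrite ler_wpM2l ?invr_ge0 ?(ltW nR0)// lerBlDr lerDl sqr_ge0.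
by field; rewrite gt_eqF.
Qed.

(* For [n = 0] the right-hand side is [2], as [0^-1 = 0]. *)
Lemma sum_inv_squares_le n : \sum_(0 <= k < n) ((k.+1 ^ 2)%:R)^-1 <= 2 - n%:R^-1 :> R.
Proof.
case: n => [|n]; first by rewrite big_geq// invr0; lra.
elim: n => [|n IH]; first by rewrite big_nat1 exp1n invr1; lra.
rewrite big_nat_recr//=; apply: (le_trans (lerD IH (lexx _))).
rewrite natrX -[n.+2]addn1 natrD.
have n0 : 0 < n.+1%:R :> R by rewrite ltr0n.
set x : R := n.+1%:R in n0 *.
rewrite -subr_ge0.
have -> : 2 - (x + 1)^-1 - (2 - x^-1 + ((x + 1) ^+ 2)^-1) = x^-1 * ((x + 1) ^+ 2)^-1.
  by field; rewrite !gt_eqF//; lra.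
by rewrite mulr_ge0// invr_ge0 ?exprn_ge0//; lra.
Qed.

(** Along squares the mean square deviations are summable, with total at most [2 * q]. Partial sums
    have increments in [[0, M]], so convergence extends to all indices. *)
Lemma strong_law_bounded (u : T -> R) (M : R) :
  measurable_fun setT u -> (forall x, 0 <= u x <= M) ->
  {ae P, forall w,
    (\sum_(i < n) u (Z i w)) / n%:R @[n --> \oo] --> \int[mu]_x u x}.
Proof.
move=> mu_ uM.
pose q := \int[mu]_x (u x ^+ 2).
have q0 : 0 <= q by apply: Rintegral_ge0 => x _; exact: sqr_ge0.
have dev0 : {ae P, forall w, average_dev u (k.+1 ^ 2) w @[k --> \oo] --> 0}.
  apply: (@ae_cvg0_summable _ _ _ _ (fun k => average_dev u (k.+1 ^ 2)) (2 * q)).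
  - by move=> k; exact: measurable_average_dev.
  - by move=> k w; exact: sqr_ge0.
  - move=> n.
    apply: (@le_trans _ _ (\sum_(0 <= k < n) (((k.+1 ^ 2)%:R^-1 * q)%:E))%E).
      by apply: lee_sum => k _; apply: average_dev_le mu_ uM; rewrite expn_gt0.
    rewrite sumEFin lee_fin -mulr_suml ler_wpM2r//.
    by rewrite (le_trans (sum_inv_squares_le n))// lerBlDr lerDl invr_ge0.
apply: filterS dev0 => w; apply: (@cvg_average_squares _ _ M) => n.
by rewrite big_ord_recr/= [_ + u _]addrC addrK uM.
Qed.

(** Two geometric sums: the powers [2^k] below [a] add up to at most [2a], and [a^2 / 2^k] over the
    powers at least [a] also adds up to at most [2a]. With [a = u x], the two kinds of terms come
    from the variance of the dyadic averages and from the number of truncated samples. *)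
Lemma sum_dyadic_truncation_le (a : R) (n : nat) : 0 <= a ->
  \sum_(0 <= k < n) ((2 ^+ k)^-1 * (if a <= 2 ^+ k then a else 0) ^+ 2
    + 2 ^+ k * (if a <= 2 ^+ k then 0 else 1)) <= 4 * a.
Proof.
move=> a0; set s := \sum_(0 <= k < n) _.
suff : if a <= 2 ^+ n then s <= 4 * a - 2 * a ^+ 2 * (2 ^+ n)^-1 else s <= 2 ^+ n.
  have p0 : 0 < (2 ^+ n)^-1 :> R by rewrite invr_gt0 exprn_gt0.
  case: ifPn => [_ /le_trans|].
    by apply; rewrite lerBlDr lerDl !mulr_ge0 ?sqr_ge0// ltW.
  by rewrite -ltNge => an sn; lra.
rewrite {}/s; elim: n => [|n IH].
  rewrite big_geq// expr0 invr1; case: ifP => // a1; nra.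
rewrite big_nat_recr//=; set s := \sum_(0 <= k < n) _ in IH *.
rewrite exprS invfM.
have p0 : 0 < 2 ^+ n :> R by rewrite exprn_gt0.
have pb : 2 ^+ n * (2 ^+ n)^-1 = 1 :> R by rewrite divff// gt_eqF.
have b0 : 0 < (2 ^+ n)^-1 :> R by rewrite invr_gt0.
set p : R := 2 ^+ n in IH p0 pb b0 *; set b := p^-1 in IH pb b0 *.
case: (leP a p) IH => [ap|pa] IH.
  have -> : a <= 2 * p by lra.
  by rewrite mulr0 addr0; lra.
rewrite expr0n/= mulr0 add0r mulr1; case: ifPn => [a2p|_]; last by lra.
(* The threshold is crossed here, as [p < a <= 2p]. This product expands to [a^2 / p <= 3a - 2p],
   which turns the bound [2p] on the sum into the invariant. *)
have : 0 <= (a - p) * (2 * p - a) * b by rewrite !mulr_ge0//; lra.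
have -> : (a - p) * (2 * p - a) * b = 3 * a * (p * b) - 2 * p * (p * b) - a ^+ 2 * b.
  by ring.
rewrite pb; lra.
Qed.

(* The dyadic averages of the truncations [u 1(u <= 2^k)] converge by
   Chebyshev, and by Borel-Cantelli almost surely only finitely many of them
   differ from those of [u]; monotonicity costs the factor 2. *)
Lemma average_eventually_le (u : T -> R) :
  (forall x, 0 <= u x) -> mu.-integrable setT (EFin \o u) ->
  {ae P, forall w, forall e, 0 < e -> \forall n \near \oo,
    \sum_(i < n) u (Z i w) <= 2 * n%:R * (\int[mu]_x u x + e)}.
Proof.
move=> u0 iu; have mu_ : measurable_fun setT u.
  by apply/measurable_EFinP; exact: measurable_int iu.
pose t k x := if u x <= 2 ^+ k then u x else 0.
pose ex k x : R := if u x <= 2 ^+ k then 0 else 1.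
have mle k : measurable_fun setT (fun x => u x <= 2 ^+ k).
  exact: measurable_fun_ler.
have mt k : measurable_fun setT (t k) by exact: measurable_fun_ifT.
have mex k : measurable_fun setT (ex k) by exact: measurable_fun_ifT.
have tM k x : 0 <= t k x <= 2 ^+ k.
  by rewrite /t; case: ifP => [->|_]; rewrite ?u0// lexx exprn_ge0.
have ex01 k x : 0 <= ex k x <= 1 by rewrite /ex; case: ifP => _; rewrite ?lexx ler01.
have ex0 k x : 0 <= ex k x by have /andP[] := ex01 k x.
have t0 k x : 0 <= t k x by have /andP[] := tM k x.
have it2 k : mu.-integrable setT (EFin \o (fun x => t k x ^+ 2)).
  apply: (@ge0_bounded_integrable _ _ _ _ ((2 ^+ k) ^+ 2)).
    exact: measurable_funX.
  by move=> x; have /andP[? ?] := tM k x; rewrite sqr_ge0 lerXn2r// nnegrE exprn_ge0.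
have iex k : mu.-integrable setT (EFin \o (ex k)).
  exact: (@ge0_bounded_integrable _ _ _ _ 1).
pose h k x := (2 ^+ k)^-1 * (t k x) ^+ 2 + 2 ^+ k * ex k x.
have ih1 k := integrableZl measurableT (2 ^+ k)^-1 (it2 k).
have ih2 k := integrableZl measurableT (2 ^+ k) (iex k).
have ih k : mu.-integrable setT (EFin \o h k).
  exact: (integrableD measurableT (ih1 k) (ih2 k)).
have Eh k : \int[mu]_x h k x =
    (2 ^+ k)^-1 * \int[mu]_x (t k x ^+ 2) + 2 ^+ k * \int[mu]_x ex k x.
  rewrite RintegralD//; [|exact: ih1|exact: ih2].
  by rewrite RintegralZl//= RintegralZl.
(* The second summand counts the first [2^k] samples that the truncation changes. Treating both
   summands at once lets a single summability bound, integrated from [sum_dyadic_truncation_le],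
   control both. *)
pose f k w := average_dev (t k) (2 ^ k) w + \sum_(i < 2 ^ k) ex k (Z i w).
have f0 : {ae P, forall w, f k w @[k --> \oo] --> 0}.
  apply: (@ae_cvg0_summable _ _ _ _ _ (4 * \int[mu]_x u x)).
  - move=> k; apply: measurable_funD; last exact: sum_measurable.
    exact: measurable_average_dev.
  - by move=> k w; rewrite addr_ge0 ?sqr_ge0 ?sumr_ge0.
  - move=> n.
    apply: (@le_trans _ _ (\sum_(0 <= k < n) ((\int[mu]_x h k x)%:E))%E).
      apply: lee_sum => k _.
      rewrite /f; under eq_integral do rewrite EFinD.
      rewrite ge0_integralD//; last 4 first.
      - by move=> w _; rewrite lee_fin sqr_ge0.
      - by apply/measurable_EFinP; exact: measurable_average_dev.
      - by move=> w _; rewrite lee_fin sumr_ge0.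
      - by apply/measurable_EFinP; exact: sum_measurable.
      rewrite Eh EFinD leeD//.
        have N0 : (0 < 2 ^ k)%N by rewrite expn_gt0.
        by have := average_dev_le N0 (mt k) (tM k); rewrite natrX.
      under eq_integral do rewrite -sumEFin.
      rewrite ge0_integral_sum//; last 2 first.
      - by move=> i; apply/measurable_EFinP; exact: measurableT_comp.
      - by move=> i w _; rewrite lee_fin.
      rewrite (eq_bigr (fun=> (\int[mu]_x ex k x)%:E)) => [|i _].
        by rewrite sumEFin sumr_const card_ord -natrX mulr_natl.
      rewrite -(ge0_Rintegral_law _ (iid.1 i))// Rintegral_EFin//.
      exact: (integrable_law (measurable_funPT (Z i)) (iid.1 i) (iex k)).
    rewrite sumEFin lee_fin -Rintegral_sum// -RintegralZl//.
    apply: le_Rintegral => //.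
    - under [X in integrable _ _ X]eq_fun do rewrite /= -sumEFin.
      by apply: integrable_sum => // k _; exact: ih.
    - exact: (integrableZl measurableT _ iu).
    - by move=> x _; exact: sum_dyadic_truncation_le.
apply: filterS f0 => w fw e e0.
have m0 : 0 <= \int[mu]_x u x by exact: Rintegral_ge0.
apply: (@le_average_dyadic _ (fun n => \sum_(i < n) u (Z i w))).
- by move=> n; rewrite big_ord_recr/= lerDl.
- by rewrite addr_ge0// ltW.
(* Below 1 the count must be 0, so [u] and its truncation agree on the samples; below [e ^+ 2] the
   truncated average is within [e] of its mean, which is at most the mean of [u]. *)
have /cvgrPdist_lt/(_ (Num.min 1 (e ^+ 2))) := fw.
rewrite lt_min ltr01 exprn_gt0// => /(_ isT).
apply: filterS => k.
have dev0 : 0 <= average_dev (t k) (2 ^ k) w by exact: sqr_ge0.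
have exs0 : 0 <= \sum_(i < 2 ^ k) ex k (Z i w) by exact: sumr_ge0.
rewrite sub0r normrN ger0_norm ?addr_ge0// lt_min => /andP[f1 fe].
have uk (i : 'I_(2 ^ k)) : u (Z i w) = t k (Z i w).
  rewrite /t; case: ifPn => // ui; exfalso.
  have : \sum_(i < 2 ^ k) ex k (Z i w) < 1 by apply: le_lt_trans f1; rewrite lerDr.
  by rewrite (bigD1 i)//= /ex (negPf ui) ltNge lerDl sumr_ge0// => j _; exact: ex0.
rewrite (eq_bigr _ (fun i _ => uk i)).
have N0 : 0 < (2 ^ k)%:R :> R by rewrite ltr0n expn_gt0.
have : average_dev (t k) (2 ^ k) w < e ^+ 2 by apply: le_lt_trans fe; rewrite lerDl.
rewrite /average_dev -(real_normK (num_real (_ - _))) ltr_pXn2r ?nnegrE ?(ltW e0)//.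
move=> /(le_lt_trans (ler_norm _)); rewrite ltrBlDr ltr_pdivrMr// => /ltW.
move=> /le_trans; apply; rewrite mulrC ler_wpM2l ?ler0n// addrC lerD2r.
apply: le_Rintegral => //.
  exact: (@ge0_bounded_integrable _ _ _ _ (2 ^+ k)).
by move=> x _; rewrite /t; case: ifP.
Qed.

End strong_law.

(** Dominated convergence for sequences that vanish from some index on at each point: the remainders
    after truncation and the weights of tail cells. *)
Lemma cvg_Rintegral_tail d (T : measurableType d) (R : realType)
    (mu : {measure set T -> \bar R}) (f : T -> R) (g : nat -> T -> R) :
    mu.-integrable setT (EFin \o f) ->
    (forall n, measurable_fun setT (g n)) ->
    (forall n x, `|g n x| <= f x) ->
    (forall x, \forall n \near \oo, g n x = 0) ->
  \int[mu]_x g n x @[n --> \oo] --> 0.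
Proof.
move=> intf mg gf g0.
have [] := @dominated_convergence _ _ _ mu setT measurableT (fun n x => (g n x)%:E)
  (cst 0%E) (EFin \o f).
- by move=> n; exact/measurable_EFinP.
- exact: measurable_cst.
- apply: aeW => x _ /=; apply: cvg_near_cst.
  by apply: filterS (g0 x) => n ->.
- exact: intf.
- by apply: aeW => x n _ /=; rewrite lee_fin.
by move=> _ _; rewrite integral0 => /fine_cvg.
Qed.

Section strong_law_integrable.
Context d d' (Omega : measurableType d) (T : measurableType d') (R : realType)
  (P : probability Omega R) (mu : probability T R) (Z : nat -> {mfun Omega >-> T}).

(** Split [u] into its truncation [v M] and the remainder [r M]. The averages of [v M] converge,
    while those of [r M] are eventually at most about twice its mean, which is small for large
    [M]. *)
Theorem strong_law_of_large_numbers (u : T -> R) :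
    pairwise_iid P mu Z ->
    (forall x, 0 <= u x) -> mu.-integrable setT (EFin \o u) ->
  {ae P, forall w,
    (\sum_(i < n) u (Z i w)) / n%:R @[n --> \oo] --> \int[mu]_x u x}.
Proof.
move=> iid u0 iu; have mu_ : measurable_fun setT u.
  by apply/measurable_EFinP; exact: measurable_int iu.
pose v (M : nat) x := Num.min (u x) M%:R.
pose r (M : nat) x := u x - v M x.
have mv M : measurable_fun setT (v M) by exact: measurable_minr.
have v0 M x : 0 <= v M x <= M%:R by rewrite /v le_min u0 ler0n/= ge_min lexx orbT.
have r0 M x : 0 <= r M x by rewrite /r subr_ge0 /v ge_min lexx.
have ru M x : r M x <= u x by rewrite /r gerBl; have /andP[] := v0 M x.
have iv M : mu.-integrable setT (EFin \o v M).
  exact: (@ge0_bounded_integrable _ _ _ _ M%:R).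
have ir M : mu.-integrable setT (EFin \o r M).
  exact: (integrableB measurableT iu (iv M)).
have r_cvg0 : \int[mu]_x r M x @[M --> \oo] --> 0.
  apply: (cvg_Rintegral_tail iu).
  - by move=> M; exact: measurable_funB.
  - by move=> M x; rewrite ger0_norm.
  - move=> x; exists (Num.truncn (u x)).+1 => // M /= uM.
    rewrite /r /v min_l ?subrr// (le_trans (ltW (truncnS_gt _)))// ler_nat//.
(* Truncation levels are natural numbers so that one null set serves all of them. *)
have all_v : {ae P, forall w, forall M,
    (\sum_(i < n) v M (Z i w)) / n%:R @[n --> \oo] --> \int[mu]_x v M x}.
  by apply: ae_foralln => M; exact: (strong_law_bounded iid (mv M) (v0 M)).
have all_r : {ae P, forall w, forall M e, 0 < e -> \forall n \near \oo,
    \sum_(i < n) r M (Z i w) <= 2 * n%:R * (\int[mu]_x r M x + e)}.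
  by apply: ae_foralln => M; exact: (average_eventually_le iid (r0 M) (ir M)).
apply: filterS2 all_v all_r => w vw rw.
apply/cvgrPdist_le => /= e e0.
(* The remainder has mean below [e / 8], so its averages are eventually at most
   [2 (e / 8 + e / 8) = e / 2]. *)
have e8 : 0 < e / 8 by lra.
have /cvgrPdist_lt/(_ _ e8)[M _ /(_ M (leqnn _))] := r_cvg0.
have Er0 : 0 <= \int[mu]_x r M x by exact: Rintegral_ge0.
rewrite /= sub0r normrN ger0_norm// => rM.
have /cvgrPdist_le/(_ _ e8) := vw M.
have := rw M _ e8.
apply: filterS3 (nbhs_infty_gt 0) => n n0 rn vn.
have nR0 : 0 < n%:R :> R by rewrite ltr0n.
have uE : \int[mu]_x u x = \int[mu]_x v M x + \int[mu]_x r M x.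
  rewrite -(RintegralD measurableT (iv M) (ir M)).
  by apply: eq_Rintegral => x _; rewrite /r addrC subrK.
have SE : (\sum_(i < n) u (Z i w)) / n%:R =
    (\sum_(i < n) v M (Z i w)) / n%:R + (\sum_(i < n) r M (Z i w)) / n%:R.
  rewrite -mulrDl -big_split/=; congr (_ / _).
  by apply: eq_bigr => i _; rewrite /r addrC subrK.
have : (\sum_(i < n) r M (Z i w)) / n%:R <= e / 2.
  rewrite ler_pdivrMr// (le_trans rn)// mulrAC ler_wpM2r ?(ltW nR0)//; lra.
have : 0 <= (\sum_(i < n) r M (Z i w)) / n%:R by rewrite divr_ge0 ?sumr_ge0.
rewrite SE uE; move: vn; rewrite !ler_norml; lra.
Qed.

End strong_law_integrable.

(** * V-statistics of order four *)

Definition fourfold d (T : measurableType d) (R : realType)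
    (m : probability T R) : probability ((T * T) * (T * T))%type R :=
  ((m \x m) \x (m \x m))%E.

Section fourfold_product.
Context d (T : measurableType d) (R : realType) (m : probability T R).

(** Bracketed like the nested product measure, so that the formula for a product of two functions
    applies at both levels. *)
Definition tensor4 (u1 u2 u3 u4 : T -> R) (z : (T * T) * (T * T)) : R :=
  (u1 z.1.1 * u2 z.1.2) * (u3 z.2.1 * u4 z.2.2).

Variables u1 u2 u3 u4 : T -> R.
Hypotheses (u1_ge0 : forall x, 0 <= u1 x) (u2_ge0 : forall x, 0 <= u2 x)
  (u3_ge0 : forall x, 0 <= u3 x) (u4_ge0 : forall x, 0 <= u4 x).
Hypotheses (i1 : m.-integrable setT (EFin \o u1))
  (i2 : m.-integrable setT (EFin \o u2)) (i3 : m.-integrable setT (EFin \o u3))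
  (i4 : m.-integrable setT (EFin \o u4)).

Let u12_ge0 (z : T * T) : 0 <= u1 z.1 * u2 z.2. Proof. exact: mulr_ge0. Qed.
Let u34_ge0 (z : T * T) : 0 <= u3 z.1 * u4 z.2. Proof. exact: mulr_ge0. Qed.
Let i12 := integrable_prodM u1_ge0 u2_ge0 i1 i2.
Let i34 := integrable_prodM u3_ge0 u4_ge0 i3 i4.

Lemma integrable_tensor4 : (fourfold m).-integrable setT (EFin \o tensor4 u1 u2 u3 u4).
Proof. exact: (integrable_prodM u12_ge0 u34_ge0 i12 i34). Qed.

Lemma Rintegral_tensor4 : \int[fourfold m]_z tensor4 u1 u2 u3 u4 z =
  (\int[m]_x u1 x * \int[m]_x u2 x) * (\int[m]_x u3 x * \int[m]_x u4 x).
Proof.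
rewrite /tensor4 (Rintegral_prodM u12_ge0 u34_ge0 i12 i34).
by rewrite (Rintegral_prodM u1_ge0 u2_ge0 i1 i2) (Rintegral_prodM u3_ge0 u4_ge0 i3 i4).
Qed.

End fourfold_product.

Section quantized_kernel.
Context d (T : measurableType d) (R : realType).
Variables (F : (T * T) * (T * T) -> R) (G : T -> R) (K : R).
Hypothesis G0 : forall x, 0 <= G x.
Hypothesis K0 : 0 <= K.
Hypothesis mF : measurable_fun setT F.
Hypothesis mG : measurable_fun setT G.
Hypothesis FG : forall z, `|F z| <= K * tensor4 G G G G z.

Definition cell (q : T -> nat) (k : nat) (x : T) : R := (q x == k)%:R.

Definition tail_weight (q : T -> nat) (N : nat) (x : T) : R :=
  (N <= q x)%:R * G x.

Definition quantize4 (q : T -> nat) (a : nat -> T) (z : (T * T) * (T * T)) :=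
  ((a (q z.1.1), a (q z.1.2)), (a (q z.2.1), a (q z.2.2))).

Variables (q : T -> nat) (a : nat -> T) (eps : R).
Hypothesis mq : measurable_fun setT q.
Hypothesis Fq : forall z,
  `|F z - F (quantize4 q a z)| <= eps * tensor4 G G G G z.
Variable N : nat.

Let Idx := (('I_N * 'I_N) * ('I_N * 'I_N))%type.

Let coef (p : Idx) := F ((a p.1.1, a p.1.2), (a p.2.1, a p.2.2)).

Definition quantized_kernel z := \sum_(p : Idx)
  coef p * tensor4 (cell q p.1.1) (cell q p.1.2) (cell q p.2.1) (cell q p.2.2) z.

(** At most one multi-index contributes at [z], the one listing the cells of the four coordinates,
    and it is missing from the sum as soon as one of these cells has index at least [N]. *)
Let quantized_kernelE z : quantized_kernel z =
  if [&& (q z.1.1 < N)%N, (q z.1.2 < N)%N, (q z.2.1 < N)%N & (q z.2.2 < N)%N]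
  then F (quantize4 q a z) else 0.
Proof.
case: ifPn => [/and4P[h1 h2 h3 h4]|out].
  pose p0 : Idx := ((Ordinal h1, Ordinal h2), (Ordinal h3, Ordinal h4)).
  rewrite /quantized_kernel (bigD1 p0)//= big1 ?addr0 => [|p pp0].
    by rewrite /tensor4 /cell/= !eqxx !mulr1.
  have : ~~ [&& q z.1.1 == p.1.1, q z.1.2 == p.1.2, q z.2.1 == p.2.1 & q z.2.2 == p.2.2].
    apply: contra pp0 => /and4P[/eqP e1 /eqP e2 /eqP e3 /eqP e4].
    case: p e1 e2 e3 e4 => -[p1 p2] [p3 p4] /= e1 e2 e3 e4.
    by rewrite !xpair_eqE/= -!val_eqE/= e1 e2 e3 e4 !eqxx.
  by rewrite /tensor4 /cell; do 4![case: eqP => _; rewrite ?mul0r ?mulr0//].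
rewrite /quantized_kernel big1// => p _; rewrite /tensor4 /cell.
case: p => -[p1 p2] [p3 p4] /=; move: out.
by do 4![case: eqP => [->|_]; rewrite ?ltn_ord ?mul0r ?mulr0//=].
Qed.

Let tail_ge0 x : 0 <= tail_weight q N x. Proof. by rewrite mulr_ge0. Qed.

(** If all four cells have index below [N], the error is that of the quantization. Otherwise the
    error is [F z], bounded by [K] times the product of the weights, and the tail tensor of a
    coordinate in a tail cell equals that product. *)
Lemma quantized_kernel_error z : 0 <= eps ->
  `|F z - quantized_kernel z| <= eps * tensor4 G G G G z + K *
   (tensor4 (tail_weight q N) G G G z + tensor4 G (tail_weight q N) G G z
    + (tensor4 G G (tail_weight q N) G z + tensor4 G G G (tail_weight q N) z)).
Proof.
move=> eps0; rewrite quantized_kernelE.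
have t0 (u1 u2 u3 u4 : T -> R) : (forall x, 0 <= u1 x) -> (forall x, 0 <= u2 x) ->
    (forall x, 0 <= u3 x) -> (forall x, 0 <= u4 x) -> 0 <= tensor4 u1 u2 u3 u4 z.
  by move=> ? ? ? ?; rewrite !mulr_ge0.
have := t0 _ _ _ _ G0 G0 G0 G0; have := t0 _ _ _ _ tail_ge0 G0 G0 G0.
have := t0 _ _ _ _ G0 tail_ge0 G0 G0; have := t0 _ _ _ _ G0 G0 tail_ge0 G0.
have := t0 _ _ _ _ G0 G0 G0 tail_ge0.
set t1 := tensor4 (tail_weight q N) _ _ _ z; set t2 := tensor4 _ (tail_weight q N) _ _ z.
set t3 := tensor4 _ _ (tail_weight q N) _ z; set t4 := tensor4 _ _ _ (tail_weight q N) z.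
set W := tensor4 G G G G z => t4_0 t3_0 t2_0 t1_0 W0.
case: ifPn => [_|out].
  by rewrite (le_trans (Fq z))// lerDl mulr_ge0// !addr_ge0.
rewrite subr0 (le_trans (FG z))// -/W -[leLHS]add0r lerD ?mulr_ge0// ler_wpM2l//.
have : [|| (N <= q z.1.1)%N, (N <= q z.1.2)%N, (N <= q z.2.1)%N | (N <= q z.2.2)%N].
  by move: out; rewrite !negb_and -!leqNgt.
have E1 : (N <= q z.1.1)%N -> t1 = W.
  by rewrite /t1 /W /tensor4 /tail_weight => ->; rewrite mul1r.
have E2 : (N <= q z.1.2)%N -> t2 = W.
  by rewrite /t2 /W /tensor4 /tail_weight => ->; rewrite mul1r.
have E3 : (N <= q z.2.1)%N -> t3 = W.
  by rewrite /t3 /W /tensor4 /tail_weight => ->; rewrite mul1r.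
have E4 : (N <= q z.2.2)%N -> t4 = W.
  by rewrite /t4 /W /tensor4 /tail_weight => ->; rewrite mul1r.
by case/or4P => [/E1|/E2|/E3|/E4]; lra.
Qed.

Variable m : probability T R.
Hypothesis iG : m.-integrable setT (EFin \o G).

Lemma measurable_cell k : measurable_fun setT (cell q k).
Proof.
by apply: (measurableT_comp (f := fun n : nat => (n == k)%:R : R)) mq.
Qed.

Lemma measurable_tail_weight : measurable_fun setT (tail_weight q N).
Proof.
apply: measurable_funM => //.
by apply: (measurableT_comp (f := fun n : nat => (N <= n)%:R : R)) mq.
Qed.

Lemma integrable_cell k : m.-integrable setT (EFin \o cell q k).
Proof.
apply: (@ge0_bounded_integrable _ _ _ _ 1); first exact: measurable_cell.
by move=> x; rewrite /cell; case: eqP => _; rewrite lexx ler01.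
Qed.

Lemma integrable_tail_weight : m.-integrable setT (EFin \o tail_weight q N).
Proof.
apply: (le_integrable measurableT _ _ iG).
  by apply/measurable_EFinP; exact: measurable_tail_weight.
move=> x _ /=; rewrite lee_fin !ger0_norm// /tail_weight.
by case: (N <= _)%N; rewrite ?mul1r ?mul0r.
Qed.

Lemma integrable_kernel : (fourfold m).-integrable setT (EFin \o F).
Proof.
have iW := integrable_tensor4 G0 G0 G0 G0 iG iG iG iG.
apply: (le_integrable measurableT _ _ (integrableZl measurableT K iW)).
  exact/measurable_EFinP.
by move=> z _ /=; rewrite lee_fin; exact: le_trans (FG z) (ler_norm _).
Qed.

Let icells (p : Idx) : (fourfold m).-integrable setT (EFin \o tensor4
  (cell q p.1.1) (cell q p.1.2) (cell q p.2.1) (cell q p.2.2)).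
Proof.
by apply: integrable_tensor4 => //; exact: integrable_cell.
Qed.

Lemma integrable_quantized_kernel : (fourfold m).-integrable setT (EFin \o quantized_kernel).
Proof.
under [X in integrable _ _ X]eq_fun do rewrite /= -sumEFin.
by apply: integrable_sum => // p _; exact: (integrableZl measurableT _ (icells p)).
Qed.

Lemma Rintegral_quantized_kernel : \int[fourfold m]_z quantized_kernel z =
  \sum_(p : Idx) coef p * ((\int[m]_x cell q p.1.1 x * \int[m]_x cell q p.1.2 x)
    * (\int[m]_x cell q p.2.1 x * \int[m]_x cell q p.2.2 x)).
Proof.
rewrite Rintegral_sum => [|p]; last exact: (integrableZl measurableT _ (icells p)).
apply: eq_bigr => p _; rewrite RintegralZl// Rintegral_tensor4//;
  exact: integrable_cell.
Qed.

Lemma Rintegral_quantized_kernel_error : 0 <= eps ->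
  `|\int[fourfold m]_z F z - \int[fourfold m]_z quantized_kernel z| <=
  eps * (\int[m]_x G x) ^+ 4
  + 4 * K * (\int[m]_x tail_weight q N x * (\int[m]_x G x) ^+ 3).
Proof.
move=> eps0.
have iW := integrable_tensor4 G0 G0 G0 G0 iG iG iG iG.
have it := integrable_tail_weight.
have iW1 := integrable_tensor4 tail_ge0 G0 G0 G0 it iG iG iG.
have iW2 := integrable_tensor4 G0 tail_ge0 G0 G0 iG it iG iG.
have iW3 := integrable_tensor4 G0 G0 tail_ge0 G0 iG iG it iG.
have iW4 := integrable_tensor4 G0 G0 G0 tail_ge0 iG iG iG it.
have iW12 := integrableD measurableT iW1 iW2.
have iW34 := integrableD measurableT iW3 iW4.
have iW1234 := integrableD measurableT iW12 iW34.
have iE := integrableZl measurableT eps iW.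
have iT := integrableZl measurableT K iW1234.
have idiff := integrableB measurableT integrable_kernel integrable_quantized_kernel.
rewrite -RintegralB//; [|exact: integrable_kernel|exact: integrable_quantized_kernel].
apply: (le_trans (le_normr_Rintegral measurableT idiff)).
apply: (le_trans (le_Rintegral measurableT _ _
  (fun z _ => quantized_kernel_error z eps0))).
- exact: integrable_norm idiff.
- exact: (integrableD measurableT iE iT).
rewrite RintegralD// RintegralZl// RintegralZl// RintegralD// RintegralD// RintegralD//.
rewrite !Rintegral_tensor4//.
set g := \int[m]_x G x; set b := \int[m]_x tail_weight q N x.
rewrite le_eqVlt; apply/orP; left; apply/eqP; ring.
Qed.
End quantized_kernel.

Section kernel_convergence.
Context d (T : measurableType d) (R : realType).
Variables (F : (T * T) * (T * T) -> R) (G : T -> R) (K : R).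
Hypothesis G0 : forall x, 0 <= G x.
Hypothesis K0 : 0 <= K.
Hypothesis mF : measurable_fun setT F.
Hypothesis mG : measurable_fun setT G.
Hypothesis FG : forall z, `|F z| <= K * tensor4 G G G G z.
Variables (q : nat -> T -> nat) (a : nat -> nat -> T).
Hypothesis mq : forall m, measurable_fun setT (q m).
Hypothesis Fq : forall m z,
  `|F z - F (quantize4 (q m) (a m) z)| <= m.+1%:R^-1 * tensor4 G G G G z.

(** The quantization error for [nu n] is bounded by a polynomial in integrals that converge to those
    of [mu]. Hence [m] and [N] chosen for [mu] alone also serve [nu n] for all large [n], without
    uniform tail estimates. *)
Lemma cvg_Rintegral_fourfold (mu : probability T R) (nu : nat -> probability T R) :
    mu.-integrable setT (EFin \o G) ->
    (forall n, (nu n).-integrable setT (EFin \o G)) ->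
    \int[nu n]_x G x @[n --> \oo] --> \int[mu]_x G x ->
    (forall m k, \int[nu n]_x cell R (q m) k x @[n --> \oo]
      --> \int[mu]_x cell R (q m) k x) ->
    (forall m N, \int[nu n]_x tail_weight G (q m) N x @[n --> \oo]
      --> \int[mu]_x tail_weight G (q m) N x) ->
  \int[fourfold (nu n)]_z F z @[n --> \oo] --> \int[fourfold mu]_z F z.
Proof.
move=> iG iGn Gcvg cellcvg tailcvg.
apply/cvgrPdist_le => /= e e0; have e4 : 0 < e / 4 by lra.
have e8 : 0 < e / 8 by lra.
set g := \int[mu]_x G x in Gcvg *.
(* The fineness [m] is fixed first, since the tail cutoff [N] depends on the cells that it
   defines. *)
have [m me] : exists m, m.+1%:R^-1 * g ^+ 4 < e / 8.
  have : harmonic n * g ^+ 4 @[n --> \oo] --> (0 : R).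
    by rewrite -[0 in X in _ --> X](mul0r (g ^+ 4)); apply: cvgMr_tmp; exact: cvg_harmonic.
  move=> /cvgrPdist_lt/(_ _ e8)[m _ /(_ m (leqnn _))].
  by rewrite /= sub0r normrN => /(le_lt_trans (ler_norm _)); exists m.
have [N Ne] : exists N, 4 * K * (\int[mu]_x tail_weight G (q m) N x * g ^+ 3) < e / 8.
  have tail0 : \int[mu]_x tail_weight G (q m) N x @[N --> \oo] --> 0.
    apply: (cvg_Rintegral_tail iG).
    - by move=> N; exact: measurable_tail_weight.
    - move=> N x; rewrite ger0_norm /tail_weight ?mulr_ge0//.
      by case: (N <= _)%N; rewrite ?mul1r ?mul0r.
    - move=> x; exists (q m x).+1 => // N /= qN.
      by rewrite /tail_weight leqNgt qN mul0r.
  have : 4 * K * (\int[mu]_x tail_weight G (q m) N x * g ^+ 3) @[N --> \oo] --> 0.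
    rewrite -[0 in X in _ --> X](mulr0 (4 * K)) -[0 in X in _ --> X](mul0r (g ^+ 3)).
    by apply: cvgMl_tmp; exact: cvgMr_tmp.
  move=> /cvgrPdist_lt/(_ _ e8)[N _ /(_ N (leqnn _))].
  by rewrite /= sub0r normrN => /(le_lt_trans (ler_norm _)); exists N.
have err_cvg : m.+1%:R^-1 * (\int[nu n]_x G x) ^+ 4
  + 4 * K * (\int[nu n]_x tail_weight G (q m) N x * (\int[nu n]_x G x) ^+ 3)
    @[n --> \oo] --> m.+1%:R^-1 * g ^+ 4
  + 4 * K * (\int[mu]_x tail_weight G (q m) N x * g ^+ 3).
  apply: cvgD.
    apply: cvgMl_tmp; exact: (cvg_comp _ _ Gcvg (@exprn_continuous R 4 _)).
  apply: cvgMl_tmp; apply: cvgM; first exact: tailcvg.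
  exact: (cvg_comp _ _ Gcvg (@exprn_continuous R 3 _)).
have qcvg : \int[fourfold (nu n)]_z quantized_kernel F (q m) (a m) N z @[n --> \oo]
    --> \int[fourfold mu]_z quantized_kernel F (q m) (a m) N z.
  rewrite (Rintegral_quantized_kernel F (a m) (mq m)).
  under eq_fun do rewrite (Rintegral_quantized_kernel F (a m) (mq m)).
  apply: cvg_big => [|p _]; first exact: add_continuous.
  apply: cvgMl_tmp.
  by apply: cvgM; apply: cvgM; exact: cellcvg.
have inv0 : 0 <= m.+1%:R^-1 :> R by rewrite invr_ge0.
have Em (P : probability T R) (iP : P.-integrable setT (EFin \o G)) :=
  Rintegral_quantized_kernel_error G0 K0 mF mG FG (mq m) (Fq m) N iP inv0.
have triangle (Fm Fn Qm Qn E En : R) : `|Fm - Qm| <= E -> `|Fn - Qn| <= En ->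
    `|E - En| < e / 4 -> `|Qm - Qn| < e / 4 -> E < e / 4 -> `|Fm - Fn| <= e.
  by rewrite !ler_norml !ltr_norml; lra.
(* The error is below [e / 4] for [mu], hence below [e / 2] for [nu n]; the quantized integrals
   differ by less than [e / 4]. *)
have Ee := ltrD me Ne; rewrite [ltRHS](_ : _ = e / 4) in Ee; last by lra.
move: err_cvg => /cvgrPdist_lt/(_ _ e4); move: qcvg => /cvgrPdist_lt/(_ _ e4).
apply: filterS2 => n Qn En.
exact: triangle (Em _ iG) (Em _ (iGn n)) En Qn Ee.
Qed.

End kernel_convergence.

(** * Integrals against the empirical measure *)

Section empirical_integral.
Context d (T : measurableType d) (R : realType) (z : nat -> T) (n : nat).
Variable u : T -> R.
Hypotheses (u0 : forall x, 0 <= u x) (mu_ : measurable_fun setT u).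

Let integral_empirical : (\int[empirical z n.+1]_x (u x)%:E =
  ((\sum_(i < n.+1) u (z i)) / n.+1%:R)%:E :> \bar R)%E.
Proof.
rewrite ge0_integral_mscale//; last 2 first.
- exact/measurable_EFinP.
- by move=> x _; rewrite lee_fin.
rewrite ge0_integral_measure_sum//; last 2 first.
- by move=> x _; rewrite lee_fin.
- exact/measurable_EFinP.
rewrite mulrC EFinM -sumEFin; congr (_ * _)%E.
apply: eq_bigr => i _; rewrite integral_dirac ?diracT ?mul1e//.
exact/measurable_EFinP.
Qed.

Lemma integrable_empirical : (empirical z n.+1).-integrable setT (EFin \o u).
Proof.
apply/integrableP; split; first exact/measurable_EFinP.
under eq_integral do rewrite gee0_abs ?lee_fin//.
by rewrite integral_empirical ltry.
Qed.

Lemma Rintegral_empirical :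
  \int[empirical z n.+1]_x u x = (\sum_(i < n.+1) u (z i)) / n.+1%:R.
Proof. by rewrite /Rintegral integral_empirical. Qed.

End empirical_integral.

Section vstatistic.
Context d (T : measurableType d) (R : realType).
Variables (F : (T * T) * (T * T) -> R) (G : T -> R) (K : R).
Hypothesis G0 : forall x, 0 <= G x.
Hypothesis K0 : 0 <= K.
Hypothesis mF : measurable_fun setT F.
Hypothesis mG : measurable_fun setT G.
Hypothesis FG : forall z, `|F z| <= K * tensor4 G G G G z.
Variables (q : nat -> T -> nat) (a : nat -> nat -> T).
Hypothesis mq : forall m, measurable_fun setT (q m).
Hypothesis Fq : forall m z,
  `|F z - F (quantize4 (q m) (a m) z)| <= m.+1%:R^-1 * tensor4 G G G G z.

(** Outside one null set the strong law holds for [G] and for all cells and tail weights, a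
    countable family; the rest is deterministic. *)
Theorem strong_law_vstatistic d' (Omega : measurableType d')
    (P : probability Omega R) (mu : probability T R) (Z : nat -> {mfun Omega >-> T}) :
    pairwise_iid P mu Z -> mu.-integrable setT (EFin \o G) ->
  {ae P, forall w,
    \int[fourfold (empirical (fun i => Z i w) n.+1)]_z F z @[n --> \oo]
      --> \int[fourfold mu]_z F z}.
Proof.
move=> iid iG.
have slln (u : T -> R) : measurable_fun setT u -> (forall x, 0 <= u x) ->
    mu.-integrable setT (EFin \o u) ->
  {ae P, forall w, \int[empirical (fun i => Z i w) n.+1]_x u x @[n --> \oo]
    --> \int[mu]_x u x}.
  move=> mu_ u0 iu.
  have := strong_law_of_large_numbers iid u0 iu.
  apply: filterS => w.
  (* The index is shifted because the empirical measure is a probability only for a positive number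
     of samples. *)
  rewrite -(cvg_shiftS (fun n => (\sum_(i < n) u (Z i w)) / n%:R)).
  have -> : (fun n => \int[empirical (fun i => Z i w) n.+1]_x u x) =
      [sequence (\sum_(i < n.+1) u (Z i w)) / n.+1%:R]_n.
    by apply/funext => n; rewrite Rintegral_empirical.
  exact.
have aeG := slln _ mG G0 iG.
have aecell : {ae P, forall w, forall m k,
    \int[empirical (fun i => Z i w) n.+1]_x cell R (q m) k x @[n --> \oo]
    --> \int[mu]_x cell R (q m) k x}.
  apply: ae_foralln => m; apply: ae_foralln => k; apply: slln.
  - exact: measurable_cell.
  - by [].
  - exact: integrable_cell.
have aetail : {ae P, forall w, forall m N,
    \int[empirical (fun i => Z i w) n.+1]_x tail_weight G (q m) N x @[n --> \oo]
    --> \int[mu]_x tail_weight G (q m) N x}.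
  apply: ae_foralln => m; apply: ae_foralln => N; apply: slln.
  - exact: measurable_tail_weight.
  - by move=> x; rewrite mulr_ge0.
  - exact: integrable_tail_weight.
apply: filterS3 aeG aecell aetail => w wG wcell wtail.
apply: (cvg_Rintegral_fourfold G0 K0 mF mG FG mq Fq) => // n.
exact: integrable_empirical.
Qed.

End vstatistic.

(** * Bounds on the kernel of distance covariance *)

Section power_estimates.
Context (R : realType).
Implicit Types (a b r s alpha : R).

(** A ratio [c / s] in [(0, 1]] is at most its own power [alpha]; add this for [c = a] and [c = b]
    with [s = a + b]. *)
Lemma powR_subadditive alpha a b : 0 < alpha <= 1 -> 0 <= a -> 0 <= b ->
  (a + b) `^ alpha <= a `^ alpha + b `^ alpha.
Proof.
move=> /andP[al0 al1] a0 b0.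
have [->|an] := eqVneq a 0; first by rewrite powR0 ?gt_eqF// !add0r.
have [->|bn] := eqVneq b 0; first by rewrite powR0 ?gt_eqF// !addr0.
have {an}a0 : 0 < a by rewrite lt_neqAle eq_sym an.
have {bn}b0 : 0 < b by rewrite lt_neqAle eq_sym bn.
set s := a + b; have s0 : 0 < s by rewrite addr_gt0.
have part c : 0 < c -> c <= s -> c / s * s `^ alpha <= c `^ alpha.
  move=> c0 cs; have cE : c = c / s * s by rewrite divfK ?gt_eqF.
  rewrite [in leRHS]cE powRM ?divr_ge0 ?(ltW s0) ?(ltW c0)//.
  rewrite ler_wpM2r ?powR_ge0// ger1_powR// divr_gt0//= ler_pdivrMr// mul1r.
  exact: cs.
have := lerD (part a a0 _) (part b b0 _).
rewrite -mulrDl -mulrDl divff ?gt_eqF// mul1r; apply.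
  by rewrite lerDl ltW.
by rewrite lerDr ltW.
Qed.

Lemma powR_hoelder alpha a b : 0 < alpha <= 1 -> 0 <= a -> 0 <= b ->
  `|a `^ alpha - b `^ alpha| <= `|a - b| `^ alpha.
Proof.
move=> al; wlog ba : a b / b <= a.
  move=> wl a0 b0; have [/wl|/ltW/wl] := leP b a; first exact.
  by rewrite distrC (distrC a b); apply.
move=> a0 b0; have al0 : 0 <= alpha by case/andP: al => /ltW.
rewrite ger0_norm ?subr_ge0 ?ge0_ler_powR ?nnegrE// ger0_norm ?subr_ge0//.
by rewrite lerBlDr -[in leLHS](subrK b a) powR_subadditive// subr_ge0.
Qed.

(* The natural number [k >= alpha] allows Bernoulli's inequality to be used in
   place of the mean value theorem. *)
Lemma powR_lipschitz alpha (k : nat) a b (M : R) : 1 <= alpha -> alpha <= k%:R ->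
  0 <= a <= M -> 0 <= b <= M ->
  `|a `^ alpha - b `^ alpha| <= k%:R * M `^ (alpha - 1) * `|a - b|.
Proof.
move=> al1 alk; wlog ba : a b / b <= a.
  move=> wl aM bM; have [/wl|/ltW/wl] := leP b a; first exact.
  by rewrite distrC (distrC a b); apply.
move=> /andP[a0 aM] /andP[b0 bM].
have al0 : 0 < alpha by rewrite (lt_le_trans ltr01).
rewrite ger0_norm ?subr_ge0 ?ge0_ler_powR ?nnegrE// ?(ltW al0)// ger0_norm ?subr_ge0//.
have [a_eq0|an] := eqVneq a 0.
  have -> : b = 0 by apply/eqP; rewrite eq_le b0 andbT -a_eq0.
  by rewrite a_eq0 !subrr mulr0.
have {an}a_gt0 : 0 < a by rewrite lt_neqAle eq_sym an.
(* By homogeneity it suffices to bound [1 - t^alpha] by [k (1 - t)], and [t^alpha >= t^k] on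
   [[0, 1]] leaves a natural exponent. *)
pose t := b / a.
have bE : b = t * a by rewrite /t divfK ?gt_eqF.
have t0 : 0 <= t by rewrite divr_ge0.
have t1 : t <= 1 by rewrite ler_pdivrMr// mul1r.
have tk : t ^+ k <= t `^ alpha.
  have [->|tn] := eqVneq t 0.
    by rewrite powR0 ?gt_eqF// expr0n; case: k alk => //; rewrite leNgt al0.
  rewrite -powR_mulrn// ger_powR// t1 andbT lt_neqAle eq_sym tn//.
have bern (n : nat) : 1 - n%:R * (1 - t) <= t ^+ n.
  elim: n => [|n IH]; first by rewrite mul0r subr0 expr0.
  rewrite exprS -natr1; have := ler_wpM2l t0 IH.
  have : 0 <= n%:R * (1 - t) * (1 - t) :> R by rewrite !mulr_ge0// subr_ge0.
  lra.
rewrite bE powRM// -[X in X - _]mul1r -mulrBl -[X in _ * (X - _)]mul1r -mulrBl.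
rewrite -(mulr_powRB1 a0 al0).
apply: (@le_trans _ _ (k%:R * (1 - t) * (a * a `^ (alpha - 1)))).
  apply: ler_wpM2r; first by rewrite mulr_ge0 ?powR_ge0.
  have := le_trans (bern k) tk; lra.
rewrite [leLHS](_ : _ = k%:R * a `^ (alpha - 1) * ((1 - t) * a)); last by ring.
apply: ler_wpM2r; first by rewrite mulr_ge0// subr_ge0.
by apply: ler_wpM2l => //; apply: ge0_ler_powR; rewrite ?nnegrE ?subr_ge0// (le_trans a0).
Qed.

(** This bound and the next are how the form of [alpha_star] enters: [alpha / 2] is the exponent
    needed for [alpha < 2], and [alpha - 1] absorbs the Lipschitz factor of the power. *)
Lemma half_alpha_star_ge alpha : alpha / 2 <= alpha_star alpha / 2.
Proof. by rewrite ler_pM2r// le_max lexx. Qed.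

Lemma half_alpha_star_ge_subr1 alpha : alpha - 1 <= alpha_star alpha / 2.
Proof.
rewrite ler_pdivlMr// /alpha_star le_max; apply/orP; right; lra.
Qed.

(** The first factor is the integer at least [alpha] required by [powR_lipschitz]; the second
    absorbs the factors 2 in [2 * r] and [2 * s]. *)
Definition power_constant alpha : R := (Num.truncn alpha).+1%:R * 2 `^ alpha.

Lemma power_constant_ge0 alpha : 0 <= power_constant alpha.
Proof. by rewrite mulr_ge0 ?powR_ge0. Qed.

(** For [alpha <= 1], Hoelder continuity gives [s^alpha <= (r s)^(alpha/2)] up to the constant. For
    [alpha > 1] the Lipschitz bound gives [r^(alpha-1) s]: if [alpha >= 2], both exponents are at
    most half of [alpha_star]; if [alpha < 2], trading [s^(1-alpha/2)] for the larger
    [r^(1-alpha/2)] yields [(r s)^(alpha/2)]. *)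
Lemma powR_dist_le alpha a b r s : 0 < alpha -> 1 <= s -> s <= r ->
  0 <= a <= 2 * r -> 0 <= b <= 2 * r -> `|a - b| <= 2 * s ->
  `|a `^ alpha - b `^ alpha| <=
  power_constant alpha * (r * s) `^ (alpha_star alpha / 2).
Proof.
move=> al0 s1 sr ar br ab; set beta := alpha_star alpha / 2.
have a0 : 0 <= a by case/andP: ar.
have b0 : 0 <= b by case/andP: br.
have r1 : 1 <= r := le_trans s1 sr.
have s0 : 0 <= s by lra.
have r0 : 0 <= r by lra.
have rs1 : 1 <= r * s by rewrite -[1]mulr1 ler_pM.
set k := (Num.truncn alpha).+1.
have alk : alpha <= k%:R by rewrite ltW// truncnS_gt.
have k1 : 1 <= k%:R :> R by rewrite ler1n.
have half_beta : (r * s) `^ (alpha / 2) <= (r * s) `^ beta.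
  by apply: ler_powR => //; exact: half_alpha_star_ge.
have [al1|al1] := leP alpha 1.
  apply: (@le_trans _ _ ((2 * s) `^ alpha)).
    have al01 : 0 < alpha <= 1 by rewrite al0.
    apply: (le_trans (powR_hoelder al01 a0 b0)).
    by apply: ge0_ler_powR; rewrite ?nnegrE ?(ltW al0)// mulr_ge0.
  rewrite powRM// /power_constant -mulrA -[leLHS]mul1r.
  apply: ler_pM => //; first by rewrite mulr_ge0 ?powR_ge0.
  apply: ler_wpM2l; first exact: powR_ge0.
  apply: le_trans half_beta; rewrite powRM//.
  rewrite [in leLHS](splitr alpha) powRD; last first.
    by apply/implyP => _; rewrite gt_eqF// (lt_le_trans ltr01).
  apply: ler_wpM2r; first exact: powR_ge0.
  by apply: ge0_ler_powR; rewrite ?nnegrE ?divr_ge0 ?(ltW al0).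
have s_neq0 : s != 0 by rewrite gt_eqF// (lt_le_trans ltr01).
have r_neq0 : r != 0 by rewrite gt_eqF// (lt_le_trans ltr01).
have core : r `^ (alpha - 1) * s <= (r * s) `^ beta.
  have [al2|al2] := leP 2 alpha.
    rewrite powRM//; apply: ler_pM; rewrite ?powR_ge0//.
      by apply: ler_powR => //; exact: half_alpha_star_ge_subr1.
    rewrite -[leLHS]powRr1//; apply: ler_powR => //.
    apply: le_trans (half_alpha_star_ge_subr1 _); lra.
  apply: le_trans half_beta; rewrite powRM//.
  have sE : s = s `^ (1 - alpha / 2) * s `^ (alpha / 2).
    rewrite -powRD; last by rewrite s_neq0 implybT.
    by rewrite subrK powRr1.
  rewrite [in leLHS]sE mulrA; apply: ler_wpM2r; first exact: powR_ge0.
  have rE : r `^ (alpha / 2) = r `^ (alpha - 1) * r `^ (1 - alpha / 2).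
    rewrite -powRD; last by rewrite r_neq0 implybT.
    by congr (_ `^ _); lra.
  rewrite rE; apply: ler_wpM2l; first exact: powR_ge0.
  by apply: ge0_ler_powR; rewrite ?nnegrE//; lra.
have M0 : 0 <= 2 * r by rewrite mulr_ge0.
apply: (le_trans (powR_lipschitz (ltW al1) alk ar br)).
apply: (@le_trans _ _ (k%:R * (2 * r) `^ (alpha - 1) * (2 * s))).
  by apply: ler_wpM2l => //; rewrite mulr_ge0 ?powR_ge0.
rewrite powRM// /power_constant -/k -(mulr_powRB1 (x := 2) (p := alpha))//.
rewrite [leLHS](_ : _ =
  k%:R * (2 * 2 `^ (alpha - 1)) * (r `^ (alpha - 1) * s)); last by ring.
by apply: ler_wpM2l => //; rewrite !mulr_ge0 ?powR_ge0.
Qed.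

(** Hoelder continuity for [alpha <= 1], Lipschitz continuity otherwise, with the factor
    [r^(alpha-1)] absorbed by the weight. The cap [delta <= 1] keeps the perturbed distances in
    [hat_small] within the range [2 * r]. *)
Lemma powR_dist_small alpha (e : R) : 0 < alpha -> 0 < e ->
  exists2 delta : R, 0 < delta <= 1 &
  forall a b r, 1 <= r -> 0 <= a <= 2 * r -> 0 <= b <= 2 * r ->
    `|a - b| <= delta ->
    `|a `^ alpha - b `^ alpha| <= e * r `^ (alpha_star alpha / 2).
Proof.
move=> al0 e0; set beta := alpha_star alpha / 2.
have beta0 : 0 <= beta.
  by apply: le_trans (half_alpha_star_ge _); rewrite divr_ge0// ltW.
have [al1|al1] := leP alpha 1.
  exists (Num.min 1 (e `^ alpha^-1)).
    by rewrite lt_min ltr01 powR_gt0//= ge_min lexx.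
  move=> a b r r1 /andP[a0 _] /andP[b0 _]; rewrite le_min => /andP[_ ab].
  have al01 : 0 < alpha <= 1 by rewrite al0.
  apply: (le_trans (powR_hoelder al01 a0 b0)).
  apply: (@le_trans _ _ ((e `^ alpha^-1) `^ alpha)).
    by apply: ge0_ler_powR; rewrite ?nnegrE ?powR_ge0 ?(ltW al0).
  rewrite -powRrM mulVf ?gt_eqF// powRr1 ?(ltW e0)// ler_peMr ?(ltW e0)//.
  by rewrite -[leLHS](powRr0 r); apply: ler_powR.
set k := (Num.truncn alpha).+1.
have alk : alpha <= k%:R by rewrite ltW// truncnS_gt.
pose C := k%:R * 2 `^ (alpha - 1) : R.
have C0 : 0 < C by rewrite mulr_gt0 ?powR_gt0.
exists (Num.min 1 (e / C)); first by rewrite lt_min ltr01 divr_gt0//= ge_min lexx.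
move=> a b r r1 ar br; rewrite le_min => /andP[_ ab].
have r0 : 0 <= r by lra.
apply: (le_trans (powR_lipschitz (ltW al1) alk ar br)).
rewrite powRM// mulrA -/C mulrAC; apply: ler_pM; rewrite ?powR_ge0//.
- by rewrite mulr_ge0 ?(ltW C0).
- by rewrite mulrC -ler_pdivlMr.
- by apply: ler_powR => //; exact: half_alpha_star_ge_subr1.
Qed.

End power_estimates.

Section hat_estimates.
Context (R : realType) (T : metricType R) (o : T) (alpha : R).
Hypothesis alpha_gt0 : 0 < alpha.
Implicit Types x y z t : T.

(** The exponent is halved because a weight on [X] gets multiplied by one on [Y] and only marginal
    moments are assumed. Adding 1 makes the base at least 1, so that powers increase with the
    exponent. *)
Definition moment_weight (x : T) : R := (1 + mdist x o) `^ (alpha_star alpha / 2).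

Local Notation g := moment_weight.
Let rho x := 1 + mdist x o.
Let rho_ge1 x : 1 <= rho x. Proof. by rewrite lerDl mdist_ge0. Qed.
Let rho_ge0 x : 0 <= rho x. Proof. exact: le_trans (rho_ge1 x). Qed.

Let beta_ge0 : 0 <= alpha_star alpha / 2.
Proof. by apply: le_trans (half_alpha_star_ge _); rewrite divr_ge0// ltW. Qed.

Let dist_le x y : 0 <= mdist x y <= rho x + rho y - 2.
Proof.
rewrite mdist_ge0/=; apply: (le_trans (metric_triangle x o y)).
rewrite (metric_sym o y) /rho; lra.
Qed.

Let dist_diff x y z : `|mdist x y - mdist x z| <= mdist y z.
Proof.
have := metric_triangle x y z; have := metric_triangle x z y.
rewrite (metric_sym z y) ler_norml; lra.
Qed.

Let prod_g t1 t2 t3 t4 : (rho t1 * rho t2 * (rho t3 * rho t4)) `^ (alpha_star alpha / 2)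
  = g t1 * g t2 * (g t3 * g t4).
Proof. by rewrite !powRM// mulr_ge0. Qed.

Let max_le_prod (r s : R) : 1 <= r -> 1 <= s -> 1 <= Num.max r s <= r * s.
Proof.
move=> r1 s1; rewrite le_max r1/= ge_max; apply/andP; split; nra.
Qed.

(* The two distances from [t1], the farthest point, differ by at most
   [d(t2, t4)]; the two others do not involve [t1]. *)
Let hat_max t1 t2 t3 t4 : rho t2 <= rho t1 -> rho t3 <= rho t1 -> rho t4 <= rho t1 ->
  `|hat alpha t1 t2 t3 t4| <=
  3 * power_constant alpha * (g t1 * g t2 * (g t3 * g t4)).
Proof.
move=> h2 h3 h4; rewrite -prod_g.
set W := (_ * _) `^ _.
have C0 := power_constant_ge0 alpha.
(* [powR_dist_le] is used with [r = rho t1], so [s] must be dominated by the other three points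
   alone. *)
have pair a b s : 1 <= s -> s <= rho t1 -> s <= rho t2 * (rho t3 * rho t4) ->
    0 <= a <= 2 * rho t1 -> 0 <= b <= 2 * rho t1 -> `|a - b| <= 2 * s ->
    `|a `^ alpha - b `^ alpha| <= power_constant alpha * W.
  move=> s1 sr sW ar br ab.
  apply: (le_trans (powR_dist_le alpha_gt0 s1 sr ar br ab)).
  apply: ler_wpM2l => //; apply: (ge0_ler_powR beta_ge0); rewrite ?nnegrE ?mulr_ge0//.
    by rewrite (le_trans ler01).
  by rewrite -mulrA ler_wpM2l.
have d12 := dist_le t1 t2; have d23 := dist_le t2 t3.
have d34 := dist_le t3 t4; have d41 := dist_le t4 t1; have d24 := dist_le t2 t4.
have := rho_ge1 t2; have := rho_ge1 t3; have := rho_ge1 t4 => r4 r3 r2.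
have /andP[m24_1 m24] := max_le_prod r2 r4.
have /andP[m34_1 m34] := max_le_prod r3 r4.
have /andP[m23_1 m23] := max_le_prod r2 r3.
have E1 : `|mdist t1 t2 `^ alpha - mdist t4 t1 `^ alpha| <= power_constant alpha * W.
  apply: (pair _ _ (Num.max (rho t2) (rho t4))) => //.
  - by rewrite ge_max h2.
  - apply: (le_trans m24); nra.
  - lra.
  - lra.
  - rewrite (metric_sym t4 t1) (le_trans (dist_diff _ _ _))//.
    have : rho t2 <= Num.max (rho t2) (rho t4) by rewrite le_max lexx.
    have : rho t4 <= Num.max (rho t2) (rho t4) by rewrite le_max lexx orbT.
    lra.
(* A lone power is its difference with the power of 0, which is 0 because [alpha] is positive. One
   paired difference and two lone powers make up the factor 3. *)
have single x y : 0 <= mdist x y <= rho x + rho y - 2 ->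
    rho x <= rho t1 -> rho y <= rho t1 ->
    Num.max (rho x) (rho y) <= rho t2 * (rho t3 * rho t4) ->
    mdist x y `^ alpha <= power_constant alpha * W.
  move=> dxy hx hy hW.
  have : rho x <= Num.max (rho x) (rho y) by rewrite le_max lexx.
  have : rho y <= Num.max (rho x) (rho y) by rewrite le_max lexx orbT.
  move=> hmy hmx.
  have := pair (mdist x y) 0 (Num.max (rho x) (rho y)).
  rewrite powR0 ?gt_eqF// !subr0 (ger0_norm (powR_ge0 _ _)); apply => //.
  - by rewrite (le_trans (rho_ge1 x)).
  - by rewrite ge_max hx.
  - have := rho_ge1 x; lra.
  - by rewrite lexx mulr_ge0.
  - by rewrite ger0_norm ?mdist_ge0//; have := rho_ge1 x; lra.
have E2 : mdist t2 t3 `^ alpha <= power_constant alpha * W.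
  apply: single => //; apply: (le_trans m23); nra.
have E3 : mdist t3 t4 `^ alpha <= power_constant alpha * W.
  apply: single => //; apply: (le_trans m34); nra.
have := powR_ge0 (mdist t2 t3) alpha; have := powR_ge0 (mdist t3 t4) alpha.
move: E1; rewrite /hat !ler_norml -mulrA; lra.
Qed.

Let hat_rot t1 t2 t3 t4 : hat alpha t1 t2 t3 t4 = - hat alpha t2 t3 t4 t1.
Proof. by rewrite /hat; ring. Qed.

(** A cyclic shift of the points only changes the sign of [hat] and leaves the product of weights
    unchanged, so the farthest point, found by three comparisons, can be moved to the first
    place. *)
Lemma hat_le t1 t2 t3 t4 : `|hat alpha t1 t2 t3 t4| <=
  3 * power_constant alpha * (g t1 * g t2 * (g t3 * g t4)).
Proof.
have rot1 : g t2 * g t3 * (g t4 * g t1) = g t1 * g t2 * (g t3 * g t4) by ring.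
have rot2 : g t3 * g t4 * (g t1 * g t2) = g t1 * g t2 * (g t3 * g t4) by ring.
have rot3 : g t4 * g t1 * (g t2 * g t3) = g t1 * g t2 * (g t3 * g t4) by ring.
have [h12|h12] := leP (rho t2) (rho t1); have [h34|h34] := leP (rho t4) (rho t3).
- have [h13|h13] := leP (rho t3) (rho t1); first by apply: hat_max; lra.
  by rewrite 2!hat_rot opprK -rot2; apply: hat_max; lra.
- have [h14|h14] := leP (rho t4) (rho t1); first by apply: hat_max; lra.
  by rewrite 3!hat_rot !opprK normrN -rot3; apply: hat_max; lra.
- have [h23|h23] := leP (rho t3) (rho t2).
    by rewrite hat_rot normrN -rot1; apply: hat_max; lra.
  by rewrite 2!hat_rot opprK -rot2; apply: hat_max; lra.
- have [h24|h24] := leP (rho t4) (rho t2).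
    by rewrite hat_rot normrN -rot1; apply: hat_max; lra.
  by rewrite 3!hat_rot !opprK normrN -rot3; apply: hat_max; lra.
Qed.

Lemma hat_small (e : R) : 0 < e -> exists2 delta : R, 0 < delta &
  forall t1 t2 t3 t4 s1 s2 s3 s4,
    mdist t1 s1 <= delta -> mdist t2 s2 <= delta ->
    mdist t3 s3 <= delta -> mdist t4 s4 <= delta ->
  `|hat alpha t1 t2 t3 t4 - hat alpha s1 s2 s3 s4| <=
  e * (g t1 * g t2 * (g t3 * g t4)).
Proof.
move=> e0; have e4 : 0 < e / 4 by lra.
have [delta /andP[delta0 delta1] Hdelta] := powR_dist_small alpha_gt0 e4.
(* Both endpoints move by at most [delta / 2], so a distance changes by at most [delta]. *)
exists (delta / 2); first lra.
move=> t1 t2 t3 t4 s1 s2 s3 s4 h1 h2 h3 h4; rewrite -prod_g.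
set W := (_ * _) `^ _.
have pair x y x' y' : mdist x x' <= delta / 2 -> mdist y y' <= delta / 2 ->
    rho x * rho y <= rho t1 * rho t2 * (rho t3 * rho t4) ->
    `|mdist x y `^ alpha - mdist x' y' `^ alpha| <= e / 4 * W.
  move=> hx hy xyW.
  have x1 := rho_ge1 x; have y1 := rho_ge1 y.
  have /andP[d0 d1] := dist_le x y.
  have xy_diff : `|mdist x y - mdist x' y'| <= delta.
    have := metric_triangle x x' y; have := metric_triangle x' y' y.
    have := metric_triangle x' x y'; have := metric_triangle x y y'.
    rewrite (metric_sym x' x) (metric_sym y' y) ler_norml; lra.
  (* The product of the two endpoint scales serves as [r]: both are at least 1, so their sum is at
     most twice their product. *)
  apply: (@le_trans _ _ (e / 4 * (rho x * rho y) `^ (alpha_star alpha / 2))).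
    apply: Hdelta => //.
    - nra.
    - rewrite d0/=; nra.
    - rewrite mdist_ge0/=; move: xy_diff; rewrite ler_norml; nra.
  apply: ler_wpM2l; first exact: ltW.
  by apply: (ge0_ler_powR beta_ge0) => //; rewrite nnegrE !mulr_ge0.
have r1 := rho_ge1 t1; have r2 := rho_ge1 t2; have r3 := rho_ge1 t3.
have r4 := rho_ge1 t4.
have p12 : 1 <= rho t1 * rho t2 by nra.
have p34 : 1 <= rho t3 * rho t4 by nra.
have p23 : 1 <= rho t2 * rho t3 by nra.
have p41 : 1 <= rho t4 * rho t1 by nra.
have rot : rho t1 * rho t2 * (rho t3 * rho t4) =
    rho t2 * rho t3 * (rho t4 * rho t1) by ring.
have E12 := pair t1 t2 s1 s2 h1 h2; have E23 := pair t2 t3 s2 s3 h2 h3.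
have E34 := pair t3 t4 s3 s4 h3 h4; have E41 := pair t4 t1 s4 s1 h4 h1.
rewrite ler_peMr ?mulr_ge0// in E12; rewrite ler_peMl ?mulr_ge0// in E34.
rewrite rot ler_peMr ?mulr_ge0// in E23; rewrite rot ler_peMl ?mulr_ge0// in E41.
have {}E12 := E12 isT; have {}E23 := E23 isT.
have {}E34 := E34 isT; have {}E41 := E41 isT.
move: E12 E23 E34 E41; rewrite /hat !ler_norml; lra.
Qed.

End hat_estimates.

(** * Separable metric spaces *)

Section borel_metric_measurability.
Context d (R : realType) (X : borelMetricType d R).

Lemma measurable_borel_ball (x : X) (e : R) : measurable (ball x e).
Proof.
rewrite borel_measurableE; apply: sub_sigma_algebra.
rewrite openE => w; rewrite /interior ballEmdist /= => xw.
rewrite -nbhs_ballE; exists (e - mdist x w) => /=; first by rewrite subr_gt0.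
move=> v; rewrite ballEmdist /= => wv.
by rewrite (le_lt_trans (metric_triangle _ w _))// -ltrBrDl.
Qed.

Hypothesis sepX : separable_space X.

(** The sets where the distance is below [r] are open, and by separability open sets of the product
    lie in the product sigma-algebra. *)
Lemma measurable_mdist : measurable_fun setT (fun p : X * X => mdist p.1 p.2).
Proof.
apply: (measurability _ (RGenInftyO.measurableE R)) => _ [_ [r ->] <-].
rewrite setTI (borel_prod sepX sepX); apply: sub_sigma_algebra.
rewrite openE => -[x y]; rewrite /interior /= in_itv/= => xyr.
rewrite -nbhs_ballE; exists ((r - mdist x y) / 2) => /=.
  by rewrite divr_gt0// subr_gt0.
move=> [u v] /= []; rewrite !ballEmdist/= => xu yv; rewrite in_itv/=.
have := metric_triangle u x v; have := metric_triangle x y v.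
rewrite (metric_sym u x); lra.
Qed.

Lemma measurable_mdist_powR d' (S : measurableType d') (f g : S -> X) (p : R) :
  measurable_fun setT f -> measurable_fun setT g ->
  measurable_fun setT (fun s => mdist (f s) (g s) `^ p).
Proof.
move=> mf mg; apply: (measurableT_comp (measurable_powR p)).
exact: (measurableT_comp measurable_mdist (measurable_fun_pair mf mg)).
Qed.

Lemma measurable_fun_nat d' (S : measurableType d') (f : S -> nat) :
  (forall k, measurable (f @^-1` [set k])) -> measurable_fun setT f.
Proof.
move=> mf _ B _; rewrite setTI.
have -> : f @^-1` B = \bigcup_(k in B) (f @^-1` [set k]).
  apply/seteqP; split => [s Bs|s [k Bk /= fsk]]; first by exists (f s).
  by rewrite /preimage/= fsk.
exact: bigcup_measurable.
Qed.

(** Send [x] to the first point of a dense sequence within [delta]; each cell is a ball minus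
    finitely many earlier balls. *)
Lemma separable_quantizer (delta : R) : 0 < delta ->
  exists (q : X -> nat) (a : nat -> X),
    measurable_fun setT q /\ forall x, mdist x (a (q x)) <= delta.
Proof.
move=> delta0; have [A cA dA] := sepX.
have near_A x : exists2 y, A y & mdist x y < delta.
  have [y [xy Ay]] : (ball x delta)° `&` A !=set0.
    apply: dA; last exact: open_interior.
    by exists x; apply: nbhsx_ballx.
  by exists y => //; have := interior_subset xy; rewrite ballEmdist.
have [a aP] : exists a : nat -> X, forall x, exists k, mdist x (a k) < delta.
  (* An empty dense set is excluded by the canonical point of the space; otherwise it is the range
     of a sequence. *)
  move: cA => /pfcard_geP[A0|[g]].
    by have [y] := near_A point; rewrite A0.
  exists g => x; have [y Ay xy] := near_A x.
  have [k _ gk] : (g @` setT) y by rewrite image_eq.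
  by exists k; rewrite gk.
exists (fun x => ex_minn (aP x)), a; split; last first.
  by move=> x; case: ex_minnP => k /ltW.
apply: measurable_fun_nat => k.
have -> : (fun x => ex_minn (aP x)) @^-1` [set k] =
    ball (a k) delta `\` \bigcup_(j in `I_k) ball (a j) delta.
  apply/seteqP; split => [x /=|x []].
    case: ex_minnP => n an min_n <-; split.
      by rewrite ballEmdist/= metric_sym.
    move=> -[j /= jn]; rewrite ballEmdist/= metric_sym => aj.
    by have := min_n _ aj; rewrite leqNgt jn.
  rewrite ballEmdist/= metric_sym => ak notj.
  case: ex_minnP => n an min_n; apply/eqP; rewrite eqn_leq min_n//= leqNgt.
  apply/negP => nk; apply: notj; exists n => //.
  by rewrite ballEmdist/= metric_sym.
apply: measurableD; first exact: measurable_borel_ball.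
by apply: bigcup_measurable => j _; exact: measurable_borel_ball.
Qed.

End borel_metric_measurability.

Lemma separable_prod_quantizer (R : realType) d1 d2 (X : borelMetricType d1 R)
    (Y : borelMetricType d2 R) (delta : R) :
    separable_space X -> separable_space Y -> 0 < delta ->
  exists (q : X * Y -> nat) (a : nat -> X * Y),
    measurable_fun setT q /\ forall z,
    mdist z.1 (a (q z)).1 <= delta /\ mdist z.2 (a (q z)).2 <= delta.
Proof.
move=> sepX sepY delta0.
have [qX [aX [mqX dX]]] := separable_quantizer sepX delta0.
have [qY [aY [mqY dY]]] := separable_quantizer sepY delta0.
exists (fun z => choice.pickle (qX z.1, qY z.2)).
(* The default [(0, 0)] is for codes of no pair, which [q] never produces. *)
exists (fun k => let p := odflt (0%N, 0%N) (choice.unpickle k) in (aX p.1, aY p.2)).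
split; last by move=> z; rewrite choice.pickleK.
apply: measurable_fun_nat => k.
have mk i j : measurable ((qX @^-1` [set i]) `*` (qY @^-1` [set j])).
  by apply: measurableX; rewrite -[_ @^-1` _]setTI; [exact: mqX|exact: mqY].
have [[[i j] <-]|nopk] := pselect (exists p : nat * nat, choice.pickle p = k).
  suff -> : (fun z => choice.pickle (qX z.1, qY z.2)) @^-1`
    [set choice.pickle (i, j)] = (qX @^-1` [set i]) `*` (qY @^-1` [set j]) by exact: mk.
  apply/seteqP; split => [[x y] /= /(pcan_inj choice.pickleK)[]//|[x y] [/= -> ->]//].
suff -> : (fun z => choice.pickle (qX z.1, qY z.2)) @^-1` [set k] = set0 by [].
by apply/seteqP; split => // z /= zk; apply: nopk; exists (qX z.1, qY z.2).
Qed.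

(** * Convergence of the empirical distance covariance *)

Lemma measurable_hat (R : realType) d d' (Z : borelMetricType d R)
    (S : measurableType d') (alpha : R) (f1 f2 f3 f4 : S -> Z) :
    separable_space Z -> measurable_fun setT f1 -> measurable_fun setT f2 ->
    measurable_fun setT f3 -> measurable_fun setT f4 ->
  measurable_fun setT (fun s => hat alpha (f1 s) (f2 s) (f3 s) (f4 s)).
Proof.
move=> sepZ mf1 mf2 mf3 mf4; apply: measurable_funB; last exact: measurable_mdist_powR.
apply: measurable_funD; last exact: measurable_mdist_powR.
by apply: measurable_funB; exact: measurable_mdist_powR.
Qed.

(** Telescoping [u v - u' v' = (u - u') v + u' (v - v')] with [|u'| <= (C + c) p] gives the factor
    [c (2C + c)]. *)
Lemma mul_dist_le (R : realDomainType) (u v u' v' p q C c e : R) :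
    `|u - u'| <= c * p -> `|v - v'| <= c * q -> `|u| <= C * p -> `|v| <= C * q ->
    0 <= p -> 0 <= q -> 0 <= C -> 0 <= c -> c <= 1 -> c * (2 * C + 1) <= e ->
  `|u * v - u' * v'| <= e * (p * q).
Proof.
move=> uu' vv' uC vC p0 q0 C0 c0 c1 ce.
have u'C : `|u'| <= (C + c) * p.
  by rewrite -[u'](subKr u) (le_trans (ler_normB _ _))// mulrDl lerD.
rewrite [u * v - _](_ : _ = (u - u') * v + u' * (v - v')); last by ring.
rewrite (le_trans (ler_normD _ _))// !normrM.
apply: (@le_trans _ _ (c * p * (C * q) + (C + c) * p * (c * q))).
  by apply: lerD; apply: ler_pM.
rewrite [leLHS](_ : _ = c * (2 * C + c) * (p * q)); last by ring.
apply: ler_wpM2r; first exact: mulr_ge0.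
by apply: le_trans ce; rewrite ler_wpM2l// lerD2l.
Qed.

(** * The kernel of distance covariance and its weight *)

Section dcov_kernel.
Context (R : realType) d1 d2 (X : borelMetricType d1 R) (Y : borelMetricType d2 R).
Variables (alpha : R) (xo : X) (yo : Y).
Hypothesis alpha_gt0 : 0 < alpha.
Hypotheses (sepX : separable_space X) (sepY : separable_space Y).

Definition dcov_kernel (z : ((X * Y) * (X * Y)) * ((X * Y) * (X * Y))) : R :=
  hat alpha z.1.1.1 z.1.2.1 z.2.1.1 z.2.2.1 *
  hat alpha z.1.1.2 z.1.2.2 z.2.1.2 z.2.2.2.

Definition pair_weight (z : X * Y) : R :=
  moment_weight xo alpha z.1 * moment_weight yo alpha z.2.

Lemma pair_weight_ge0 z : 0 <= pair_weight z.
Proof. by rewrite mulr_ge0 ?powR_ge0. Qed.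

(** Integrability makes the extended-real expectation finite, so that the limit can be taken in the
    reals. *)
Lemma dcovE (mu : probability (X * Y)%type R) :
  (fourfold mu).-integrable setT (EFin \o dcov_kernel) ->
  dcov alpha mu = (4^-1 * \int[fourfold mu]_z dcov_kernel z)%:E.
Proof.
move=> iF; rewrite EFinM /Rintegral fineK; last exact: integrable_fin_num iF.
rewrite /dcov unlock; congr (_ * _)%E.
by apply: eq_integral => -[[z1 z2] [z3 z4]] _.
Qed.

Let tensor_weight t1 t2 t3 t4 :
  tensor4 pair_weight pair_weight pair_weight pair_weight ((t1, t2), (t3, t4)) =
  (moment_weight xo alpha t1.1 * moment_weight xo alpha t2.1 *
    (moment_weight xo alpha t3.1 * moment_weight xo alpha t4.1)) *
  (moment_weight yo alpha t1.2 * moment_weight yo alpha t2.2 *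
    (moment_weight yo alpha t3.2 * moment_weight yo alpha t4.2)).
Proof. by rewrite /tensor4 /pair_weight/=; ring. Qed.

Definition kernel_constant : R := (3 * power_constant alpha) ^+ 2.

Lemma dcov_kernel_le z : `|dcov_kernel z| <= kernel_constant *
  tensor4 pair_weight pair_weight pair_weight pair_weight z.
Proof.
case: z => [[t1 t2] [t3 t4]]; rewrite /dcov_kernel /kernel_constant tensor_weight/=.
rewrite normrM expr2 mulrACA; apply: ler_pM => //; exact: hat_le.
Qed.

Lemma dcov_kernel_small (e : R) : 0 < e -> exists2 delta : R, 0 < delta &
  forall q a, (forall z : X * Y,
    mdist z.1 (a (q z)).1 <= delta /\ mdist z.2 (a (q z)).2 <= delta) ->
  forall z, `|dcov_kernel z - dcov_kernel (quantize4 q a z)| <=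
    e * tensor4 pair_weight pair_weight pair_weight pair_weight z.
Proof.
move=> e0; pose C := 3 * power_constant alpha.
have C0 : 0 <= C by rewrite mulr_ge0 ?power_constant_ge0.
pose c := Num.min 1 (e / (2 * C + 1)).
have D0 : 0 < 2 * C + 1 by lra.
have c0 : 0 < c by rewrite lt_min ltr01 divr_gt0.
have c1 : c <= 1 by rewrite ge_min lexx.
have cD : c * (2 * C + 1) <= e by rewrite -ler_pdivlMr// ge_min lexx orbT.
have [dX dX0 HX] := hat_small xo alpha_gt0 c0.
have [dY dY0 HY] := hat_small yo alpha_gt0 c0.
exists (Num.min dX dY); first by rewrite lt_min dX0.
move=> q a qa [[t1 t2] [t3 t4]].
have qX t : mdist t.1 (a (q t)).1 <= dX.
  by have [+ _] := qa t; rewrite le_min => /andP[].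
have qY t : mdist t.2 (a (q t)).2 <= dY.
  by have [_ +] := qa t; rewrite le_min => /andP[].
have HX4 := HX _ _ _ _ _ _ _ _ (qX t1) (qX t2) (qX t3) (qX t4).
have HY4 := HY _ _ _ _ _ _ _ _ (qY t1) (qY t2) (qY t3) (qY t4).
have BX := hat_le xo alpha_gt0 t1.1 t2.1 t3.1 t4.1.
have BY := hat_le yo alpha_gt0 t1.2 t2.2 t3.2 t4.2.
rewrite tensor_weight /dcov_kernel/=.
by apply: mul_dist_le HX4 HY4 BX BY _ _ _ _ _ _ => //; rewrite ?mulr_ge0 ?powR_ge0 ?(ltW c0).
Qed.

Lemma measurable_dcov_kernel : measurable_fun setT dcov_kernel.
Proof.
have m1 : measurable_fun setT (fun z : (X * Y * (X * Y)) * (X * Y * (X * Y)) => z.1.1).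
  exact: (measurableT_comp measurable_fst measurable_fst).
have m2 : measurable_fun setT (fun z : (X * Y * (X * Y)) * (X * Y * (X * Y)) => z.1.2).
  exact: (measurableT_comp measurable_snd measurable_fst).
have m3 : measurable_fun setT (fun z : (X * Y * (X * Y)) * (X * Y * (X * Y)) => z.2.1).
  exact: (measurableT_comp measurable_fst measurable_snd).
have m4 : measurable_fun setT (fun z : (X * Y * (X * Y)) * (X * Y * (X * Y)) => z.2.2).
  exact: (measurableT_comp measurable_snd measurable_snd).
apply: measurable_funM.
  by apply: (measurable_hat _ sepX); apply: (measurableT_comp measurable_fst).
by apply: (measurable_hat _ sepY); apply: (measurableT_comp measurable_snd).
Qed.

Lemma measurable_moment_weight d (Z : borelMetricType d R) (o : Z) :
  separable_space Z -> measurable_fun setT (moment_weight o alpha).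
Proof.
move=> sepZ; apply: (measurableT_comp (measurable_powR _)).
apply: measurable_funD => //.
exact: (measurableT_comp (measurable_mdist sepZ)
  (measurable_fun_pair (@measurable_id _ _ setT) (measurable_cst o))).
Qed.

Lemma measurable_pair_weight : measurable_fun setT pair_weight.
Proof.
apply: measurable_funM.
  exact: (measurableT_comp (measurable_moment_weight xo sepX) measurable_fst).
exact: (measurableT_comp (measurable_moment_weight yo sepY) measurable_snd).
Qed.

Let alpha_star_gt0 : 0 < alpha_star alpha.
Proof. by rewrite lt_max alpha_gt0. Qed.

(** Squaring restores the full exponent [alpha_star]; then [1 + r] is at most 2 or at most [2r],
    according to whether [r <= 1]. *)
Lemma moment_weight_sqr_le d (Z : borelMetricType d R) (o z : Z) :
  moment_weight o alpha z ^+ 2 <=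
  2 `^ alpha_star alpha * (1 + mdist z o `^ alpha_star alpha).
Proof.
have r0 : 0 <= mdist z o by exact: mdist_ge0.
rewrite -powR_mulrn ?powR_ge0// -powRrM divfK//.
have [r1|r1] := leP (mdist z o) 1.
  apply: (@le_trans _ _ (2 `^ alpha_star alpha)).
    by apply: (ge0_ler_powR (ltW alpha_star_gt0)); rewrite ?nnegrE; lra.
  by rewrite ler_peMr ?powR_ge0// lerDl powR_ge0.
apply: (@le_trans _ _ ((2 * mdist z o) `^ alpha_star alpha)).
  by apply: (ge0_ler_powR (ltW alpha_star_gt0)); rewrite ?nnegrE; lra.
by rewrite powRM// ler_wpM2l ?powR_ge0// lerDr.
Qed.

Lemma integrable_pair_weight (mu : probability (X * Y)%type R) :
    (\int[mu]_z (mdist z.1 xo `^ alpha_star alpha)%:E < +oo)%E ->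
    (\int[mu]_z (mdist z.2 yo `^ alpha_star alpha)%:E < +oo)%E ->
  mu.-integrable setT (EFin \o pair_weight).
Proof.
move=> momX momY.
have mX : measurable_fun setT (fun z : X * Y => mdist z.1 xo `^ alpha_star alpha).
  by apply: measurable_mdist_powR.
have mY : measurable_fun setT (fun z : X * Y => mdist z.2 yo `^ alpha_star alpha).
  by apply: measurable_mdist_powR.
have iX : mu.-integrable setT (EFin \o (fun z : X * Y => mdist z.1 xo `^ alpha_star alpha)).
  apply/integrableP; split; first exact/measurable_EFinP.
  by under eq_integral do rewrite gee0_abs ?lee_fin ?powR_ge0//.
have iY : mu.-integrable setT (EFin \o (fun z : X * Y => mdist z.2 yo `^ alpha_star alpha)).
  apply/integrableP; split; first exact/measurable_EFinP.
  by under eq_integral do rewrite gee0_abs ?lee_fin ?powR_ge0//.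
have i2 : mu.-integrable setT (EFin \o cst (2 : R)).
  exact: finite_measure_integrable_cst.
have i2XY := integrableZl measurableT (2 `^ alpha_star alpha)
  (integrableD measurableT i2 (integrableD measurableT iX iY)).
apply: (le_integrable measurableT _ _ i2XY).
  by apply/measurable_EFinP; exact: measurable_pair_weight.
move=> z _ /=; rewrite lee_fin ger0_norm ?pair_weight_ge0//.
apply: le_trans (ler_norm _).
have := moment_weight_sqr_le xo z.1; have := moment_weight_sqr_le yo z.2.
rewrite /pair_weight; set p := 2 `^ _.
(* This square bounds twice the product of the weights by the sum of their squares; with the next
   one, that sum is nonnegative, so the factor one half may be given away. *)
have := sqr_ge0 (moment_weight xo alpha z.1 - moment_weight yo alpha z.2).
have := sqr_ge0 (moment_weight xo alpha z.1 + moment_weight yo alpha z.2).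
rewrite sqrrB sqrrD; lra.
Qed.

End dcov_kernel.

Lemma independent_copies_pairwise_iid d d' d0 (Omega : measurableType d)
    (T : measurableType d') (R : realType) (P : probability Omega R)
    (Omega0 : measurableType d0) (P0 : probability Omega0 R) (Z0 : {RV P0 >-> T})
    (Z : nat -> {RV P >-> T}) :
  independent_copies Z0 Z -> pairwise_iid P (distribution P0 Z0) Z.
Proof.
move=> [indep law]; split => [i A mA|i j A B ij mA mB]; first exact: law.
transitivity (P (Z i @^-1` A) * P (Z j @^-1` B))%E; last first.
  by congr (_ * _)%E; exact: law.
(* Mutual independence is applied to the index set [{i, j}]; the values at other indices are
   immaterial. *)
pose AB k := if k == i then A else B.
have mAB k : measurable (AB k) by rewrite /AB; case: ifP.
have := indep [fset i; j]%fset AB mAB.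
rewrite big_fsetU1/= ?inE// big_seq_fset1 /AB eqxx eq_sym (negPf ij).
move=> <-; congr (P _); apply/seteqP; split.
  move=> w [Aw Bw] k /=; rewrite !inE => /orP[/eqP->|/eqP->].
    by rewrite eqxx.
  by rewrite eq_sym (negPf ij).
move=> w ABw; split.
  by have := ABw i; rewrite /= !inE eqxx => /(_ isT).
by have := ABw j; rewrite /= !inE eqxx orbT eq_sym (negPf ij) => /(_ isT).
Qed.

Theorem theorem4p4 (R : realType) (alpha : R) (alpha_gt0 : 0 < alpha)
  (dX dY : measure_display)
  (X : borelMetricType dX R) (Y : borelMetricType dY R)
  (sepX : separable_space X) (sepY : separable_space Y)
  (xo : X) (yo : Y)
  (d0 : measure_display) (Omega0 : measurableType d0)
  (P0 : probability Omega0 R) (XY : {RV P0 >-> (X * Y)%type})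
  (momentX :
    ('E_P0[fun w => (mdist (XY w).1 xo `^ alpha_star alpha)%R] < +oo)%E)
  (momentY :
    ('E_P0[fun w => (mdist (XY w).2 yo `^ alpha_star alpha)%R] < +oo)%E)
  (d : measure_display) (Omega : measurableType d) (P : probability Omega R)
  (XYs : nat -> {RV P >-> (X * Y)%type})
  (copies : independent_copies XY XYs) :
  {ae P, forall w,
    dcov alpha (empirical (fun i => XYs i w) n.+1) @[n --> \oo]
      --> dcov alpha (distribution P0 XY)}.
Proof.
have iid := independent_copies_pairwise_iid copies.
set mu := distribution P0 XY in iid *.
have W0 := @pair_weight_ge0 R dX dY X Y alpha xo yo.
have mW := measurable_pair_weight alpha xo yo sepX sepY.
have mF := @measurable_dcov_kernel R dX dY X Y alpha sepX sepY.
have FW := dcov_kernel_le xo yo alpha_gt0.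
have K0 : 0 <= kernel_constant alpha by exact: sqr_ge0.
have iW : mu.-integrable setT (EFin \o pair_weight alpha xo yo).
  apply: integrable_pair_weight => //.
  - rewrite ge0_integral_distribution//; first by move: momentX; rewrite unlock.
    + by apply/measurable_EFinP; exact: measurable_mdist_powR.
    + by move=> z; rewrite lee_fin powR_ge0.
  - rewrite ge0_integral_distribution//; first by move: momentY; rewrite unlock.
    + by apply/measurable_EFinP; exact: measurable_mdist_powR.
    + by move=> z; rewrite lee_fin powR_ge0.
(* Countably many quantizers, of error [1 / (m + 1)] relative to the weights, are chosen before the
   sample point [w], so that the strong law applies to all their cells at once. *)
have /choice[qa qaP] : forall m : nat, exists qa : (X * Y -> nat) * (nat -> X * Y),
    measurable_fun setT qa.1 /\ forall z,
    `|dcov_kernel alpha z - dcov_kernel alpha (quantize4 qa.1 qa.2 z)| <=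
    m.+1%:R^-1 * tensor4 (pair_weight alpha xo yo) (pair_weight alpha xo yo)
      (pair_weight alpha xo yo) (pair_weight alpha xo yo) z.
  move=> m; have m0 : 0 < m.+1%:R^-1 :> R by rewrite invr_gt0.
  have [delta delta0 small] := dcov_kernel_small xo yo alpha_gt0 m0.
  have [q [a [mq aq]]] := separable_prod_quantizer sepX sepY delta0.
  by exists (q, a); split => //; exact: small.
have := @strong_law_vstatistic _ _ R _ _ _ W0 K0 mF mW FW
  (fun m => (qa m).1) (fun m => (qa m).2) (fun m => (qaP m).1) (fun m => (qaP m).2)
  _ _ _ _ _ iid iW.
apply: filterS => w.
rewrite (dcovE (integrable_kernel W0 mF FW iW)).
have -> : (fun n => dcov alpha (empirical (fun i => XYs i w) n.+1)) =
    (fun n => (4^-1 * \int[fourfold (empirical (fun i => XYs i w) n.+1)]_z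
      dcov_kernel alpha z)%:E).
  (* Every nonnegative measurable function is integrable for an empirical measure, so [dcovE] holds
     for each [n] and each [w]. *)
  apply/funext => n; rewrite -dcovE//.
  by apply: (integrable_kernel W0 mF FW); exact: integrable_empirical.
by move=> cvg4; apply: cvg_EFin; [exact: nearW|exact: cvgMl_tmp].
Qed.
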